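(* Let $X$ be a Banach space, let $Y$ be a reflexive and separable Banach space, let $K\subset Y$ be a closed convex normal cone, and let $k\in K\setminus\{0\}$. Let $\Omega\subset X$ be an open convex set and let $f:\Omega\to Y$ be strongly $\alpha(\cdot)$-$k$-paraconvex on $\Omega$. Then: (i) if $X$ is a separable Asplund space and $K$ has a bounded base, then $f$ is Fréchet differentiable at every point of some dense $G_\delta$ subset of $\Omega$; (ii) if $X$ is separable, then $f$ is Gâteaux differentiable at every point of some dense $G_\delta$ subset of $\Omega$.
   Context: Spaces are real. $\alpha:[0,+\infty)\to[0,+\infty)$ is a nondecreasing function with $\lim_{t\to 0^+}\alpha(t)/t=0$. A convex cone $K\subset Y$ is a set with $K+K\subset K$ and $\lambda K\subset K$ for all $\lambda\ge 0$; it defines the relation $x\le_K y \Leftrightarrow y-x\in K$. The cone $K$ is normal if there is $\gamma>0$ such that $0\le_K x\le_K y$ implies $\|x\|\le\gamma\|y\|$ for all $x,y\in Y$. A convex set $B\subset K$ is a base for $K$ if $K=\bigcup\{\lambda b:\lambda\ge0,\ b\in B\}$ and $0\notin\operatorname{cl}B$; a bounded base is a base that is norm bounded. For an open convex set $\Omega\subset X$ and $0\ne k\in K$, a continuous mapping $f$ into $Y$ is strongly $\alpha(\cdot)$-$k$-paraconvex on $\Omega$ if there is a constant $C>0$ such that for all $x,y\in\Omega$ and $0\le\lambda\le1$ $$f(\lambda x+(1-\lambda)y)\le_K \lambda f(x)+(1-\lambda)f(y)+C\min\{\lambda,1-\lambda\}\,\alpha(\|x-y\|)\,k.$$ $f$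 is Gâteaux differentiable at $x_0$ if the norm limit $f'(x_0;h)=\lim_{t\to0}\frac{f(x_0+th)-f(x_0)}{t}$ (two-sided in $t$) exists for every $h\in X$ and $h\mapsto f'(x_0;h)$ is linear and continuous. An Asplund space is a Banach space on which every continuous convex real-valued function defined on an open convex subset is Fréchet differentiable on a dense $G_\delta$ subset of its domain. *)

(* Defs.v *)
From HB Require Import structures.
From mathcomp Require Import all_boot all_order all_algebra.
From mathcomp Require Import all_classical all_reals all_analysis borel_hierarchy.

Set Implicit Arguments.
Unset Strict Implicit.
Unset Printing Implicit Defensive.

Import Order.TTheory GRing.Theory Num.Theory.
Import numFieldNormedType.Exports.

Local Open Scope classical_set_scope.
Local Open Scope ring_scope.

Definition separable_space (T : topologicalType) : Prop :=
  exists2 S : set T, countable S & dense S.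

Section Reflexivity.
Context {R : realType} {Y : normedModType R}.

Definition dual : set (Y -> R^o) :=
  [set phi | linear phi /\ continuous phi].

Definition dual_norm (phi : Y -> R^o) : R :=
  sup [set `|phi y| | y in [set y : Y | `|y| <= 1]].

(* A bidual element is given as a map on all functions Y -> R, of which only
   the restriction to [dual] matters. *)
Definition bidual : set ((Y -> R^o) -> R) :=
  [set Phi |
    (forall (a : R) (phi psi : Y -> R^o), dual phi -> dual psi ->
      Phi (fun y => a *: phi y + psi y) = a * Phi phi + Phi psi) /\
    exists M : R, forall phi, dual phi -> `|Phi phi| <= M * dual_norm phi].

End Reflexivity.

(* The canonical embedding of Y into its bidual is onto. *)
Definition reflexive_space (R : realType) (Y : normedModType R) : Prop :=
  forall Phi, @bidual R Y Phi ->
    exists y : Y, forall phi, dual phi -> Phi phi = phi y.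

Section Cones.
Context {R : realType} {Y : normedModType R}.
Implicit Types K B : set Y.

Definition convex_cone K : Prop :=
  (forall x y, K x -> K y -> K (x + y)) /\
  (forall (l : R) x, 0 <= l -> K x -> K (l *: x)).

Definition cone_le K (x y : Y) : Prop := K (y - x).

Definition normal_cone K : Prop :=
  exists2 gamma : R, 0 < gamma &
    forall x y : Y, cone_le K 0 x -> cone_le K x y -> `|x| <= gamma * `|y|.

Definition cone_base K B : Prop :=
  [/\ convex_set (B : set (convex_lmodType Y)), B `<=` K,
      K = [set y | exists l b, [/\ 0 <= l, B b & y = l *: b]] &
      ~ closure B 0].

Definition has_bounded_base K : Prop :=
  exists2 B, cone_base K B & bounded_set B.

End Cones.

Definition strongly_paraconvex (R : realType) (X Y : normedModType R)
    (K : set Y) (alpha : R -> R) (k : Y) (Omega : set X) (f : X -> Y) : Prop :=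
  {within Omega, continuous f} /\
  exists2 C : R, 0 < C &
    forall (x y : X) (l : R), Omega x -> Omega y -> 0 <= l <= 1 ->
      cone_le K (f (l *: x + (1 - l) *: y))
        (l *: f x + (1 - l) *: f y
         + (C * Num.min l (1 - l) * alpha `|x - y|) *: k).

Definition gateaux_differentiable (R : realType) (X Y : normedModType R)
    (f : X -> Y) (x0 : X) : Prop :=
  [/\ forall h : X, derivable f x0 h,
      linear (fun h : X => 'D_h f x0) &
      continuous (fun h : X => 'D_h f x0)].

(* P holds on a dense G_delta subset of D; for open D, the G_delta sets of D
   are the G_delta sets of the whole space contained in D. *)
Definition on_dense_Gdelta (T : topologicalType) (D : set T) (P : T -> Prop)
    : Prop :=
  exists G : set T,
    [/\ G `<=` D, Gdelta G, D `<=` closure G & forall x, G x -> P x].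

Definition asplund (R : realType) (X : completeNormedModType R) : Prop :=
  forall (D : set X) (g : X -> R^o),
    open D -> convex_set (D : set (convex_lmodType X)) ->
    {within D, continuous g} ->
    convex_function (D : set (convex_lmodType X)) g ->
    on_dense_Gdelta D (fun x => differentiable g x).

(* Main.v *)
(** For phi in the dual cone of K, the scalar function phi o f is paraconvex,
   and by reflexivity and normality the difference quotients of f, which decrease in
   the order of K up to a vanishing multiple of k, converge in norm. So f has
   one-sided directional derivatives f'(x; h), sublinear in h for the order of
   K, and it is (Gateaux) differentiable where f'(x; h) + f'(x; -h), an element
   of K, vanishes.

   (ii) K carries a sequence of positive functionals separating its points from
   0. For each of them and each h in a dense sequence, the evaluated sum is 0 on
   a dense G_delta: on an open set without such points all symmetric second
   differences would be at least e t, which iterated doubling of t excludes.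

   (i) A bounded base yields phi with phi y >= c |y| on K, which reduces the
   claim to phi o f. Let s(v) be the supremum of phi (f'(x; v)) over x in a small
   ball. This sublinear function is Frechet differentiable at some v0 as X is
   Asplund, so the elements of the corresponding slice of directional
   derivatives are uniformly close to one linear form. By paraconvexity the
   slice is attained on a nonempty open set of points x, where phi o f is then
   almost linear. *)

Require Import Defs.
From HB Require Import structures.
From mathcomp Require Import all_boot all_order all_algebra.
From mathcomp Require Import all_classical all_reals all_analysis borel_hierarchy.
From mathcomp Require Import ring lra.

Set Implicit Arguments.
Unset Strict Implicit.
Unset Printing Implicit Defensive.

Import Order.TTheory GRing.Theory Num.Theory.
Import numFieldNormedType.Exports.

Local Open Scope classical_set_scope.
Local Open Scope ring_scope.

(** * Generic properties *)

Lemma separable_sequence (T : ptopologicalType) : separable_space T ->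
  exists s : nat -> T, dense (range s).
Proof.
move=> [S cS dS]; have [x Sx] : S !=set0.
  by have [|x [_ Sx]] := dS setT _ openT; [exists point|exists x].
have /pfcard_geP[S0|[s]] := cS; first by move: Sx; rewrite S0.
by exists s; rewrite (@image_eq _ _ _ _ s).
Qed.

(** * Baire category relative to an open set *)

Section DenseGdelta.
Context {R : realType} {X : completeNormedModType R} {D : set X}.
Hypothesis openD : open D.

(** The Baire theorem concerns the whole space, so each [O n] is cut down to [D] and enlarged by the
    exterior of [D]: these sets are open and dense in [X], and inside [D] they agree with [O n]. *)
Lemma on_dense_Gdelta_bigcap (O : nat -> set X) :
  (forall n, open (O n)) -> (forall n, D `<=` closure (O n)) ->
  on_dense_Gdelta D (fun x => forall n, O n x).
Proof.
move=> oO dO; have oDO n : open (D `&` O n) by exact: openI.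
have dense_ext n : open (D `&` O n `|` ~` closure D) /\
    dense (D `&` O n `|` ~` closure D).
  split; first by apply: openU => //; exact/closed_openC/closed_closure.
  move=> B [b Bb] oB; have [bD|bD] := pselect (closure D b); last first.
    by exists b; split => //; right.
  have [d [Dd Bd]] := bD B (open_nbhs_nbhs (conj oB Bb)).
  have [z [Oz [Dz Bz]]] := dO n d Dd (D `&` B)
    (open_nbhs_nbhs (conj (openI openD oB) (conj Dd Bd))).
  by exists z; split => //; left.
exists (\bigcap_n (D `&` O n)); split.
- by move=> x /(_ 0%N I)[].
- by exists (fun n => D `&` O n).
- move=> x Dx B /nbhs_interior xB.
  have [||z [[Dz Bz] zO]] := Baire dense_ext (O := D `&` B^°).
  + by exists x; split => //; exact: nbhs_singleton xB.
  + by apply: openI => //; exact: open_interior.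
  + exists z; split; last exact: interior_subset.
    move=> n _; have [//|] := zO n I.
    by move=> nDz; exfalso; apply: nDz; exact: subset_closure.
- by move=> x xG n; have [] := xG n I.
Qed.

Lemma on_dense_Gdelta_forall (P : nat -> X -> Prop) :
  (forall n, on_dense_Gdelta D (P n)) ->
  on_dense_Gdelta D (fun x => forall n, P n x).
Proof.
move=> dP; have [G GP] := choice dP.
have /choice[Os OP] n : exists U : nat -> set X,
    (forall m, open (U m)) /\ G n = \bigcap_m (U m).
  by have [_ [U oU GU] _ _] := GP n; exists U.
(* Numbers that code no pair are sent to (0, 0), which merely repeats one of the open sets. *)
pose pr i : nat * nat := odflt (0, 0)%N (unpickle i).
have [i|i x Dx|H [HD dH clH HO]] :=
  on_dense_Gdelta_bigcap (O := fun i => Os (pr i).1 (pr i).2).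
- exact: (OP _).1.
- have [_ _ /(_ x Dx) + _] := GP (pr i).1; rewrite (OP _).2.
  by apply: closureS => y; exact.
- exists H; split => // x Hx n; have [_ _ _] := GP n; apply.
  rewrite (OP n).2 => m _; have := HO x Hx (pickle (n, m)).
  by rewrite /pr pickleK.
Qed.

Lemma on_dense_Gdelta_impl (P Q : X -> Prop) :
  (forall x, D x -> P x -> Q x) ->
  on_dense_Gdelta D P -> on_dense_Gdelta D Q.
Proof.
move=> PQ [G [GD dG clG GP]]; exists G; split => // x Gx.
by apply: PQ; [exact: GD|exact: GP].
Qed.

End DenseGdelta.

(** * Hahn-Banach and separation *)

Section LinearFunctions.
Context {R : pzRingType} {V W : lmodType R} {f : V -> W}.
Hypothesis lf : linear f.

Let F : {linear V -> W} := HB.pack f (GRing.isLinear.Build _ _ _ _ f lf).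

Lemma linf0 : f 0 = 0. Proof. exact: (linear0 F). Qed.
Lemma linfD x y : f (x + y) = f x + f y. Proof. exact: (linearD F). Qed.
Lemma linfN x : f (- x) = - f x. Proof. exact: (linearN F). Qed.
Lemma linfB x y : f (x - y) = f x - f y. Proof. exact: (linearB F). Qed.
Lemma linfZ a x : f (a *: x) = a *: f x. Proof. exact: (linearZ_LR F). Qed.

End LinearFunctions.

Section HahnBanach.
Context {R : realType} {V : lmodType R}.
Implicit Types (p q : V -> R) (N : set (V * R)).

Definition sublinear q : Prop :=
  (forall x y, q (x + y) <= q x + q y) /\
  (forall t x, 0 < t -> q (t *: x) <= t * q x).

Lemma sublinear0 q : sublinear q -> q 0 = 0.
Proof.
move=> [_ qZ]; have := qZ 2 0; have := qZ 2^-1 0.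
by rewrite !scaler0 => /(_ ltac:(lra)) + /(_ ltac:(lra)); lra.
Qed.

Lemma sublinear_ge q x : sublinear q -> - q (- x) <= q x.
Proof.
move=> sq; have := sq.1 x (- x); rewrite subrr (sublinear0 sq); lra.
Qed.

Lemma sublinearZ q t x : sublinear q -> 0 < t -> q (t *: x) = t * q x.
Proof.
move=> [_ qZ] t0; apply/eqP; rewrite eq_le qZ//=.
have := qZ t^-1 (t *: x); rewrite invr_gt0 => /(_ t0).
by rewrite scalerA mulVf ?gt_eqF// scale1r -ler_pdivlMl// mulrC.
Qed.

(** For a cone [N] of pairs (v, c) with c <= p v, containing the origin, a linear form below
    [inf_translate p N] is below [p] and has at each such v a value at least c. *)
Definition inf_translate p N (v : V) : R := inf [set p (v + n.1) - n.2 | n in N].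

Section InfTranslate.
Variables (p : V -> R) (N : set (V * R)).
Hypotheses (sp : sublinear p) (N0 : N (0, 0)).
Hypothesis ND : forall n m, N n -> N m -> N (n.1 + m.1, n.2 + m.2).
Hypothesis NZ : forall t n, 0 < t -> N n -> N (t *: n.1, t * n.2).
Hypothesis Np : forall n, N n -> n.2 <= p n.1.

Lemma inf_translate_le v n : N n -> inf_translate p N v <= p (v + n.1) - n.2.
Proof.
move=> Nn; apply: ge_inf; last by exists n.
(* Since n.2 <= p n.1 <= p (v + n.1) + p (- v), the infimum is finite. *)
exists (- p (- v)) => _ [m Nm <-].
have := sp.1 (v + m.1) (- v); rewrite addrAC subrr add0r.
have := Np Nm; lra.
Qed.

Lemma le_inf_translate v c :
  (forall n, N n -> c <= p (v + n.1) - n.2) -> c <= inf_translate p N v.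
Proof.
move=> cN; apply: lb_le_inf; first by exists (p (v + 0) - 0), (0, 0).
by move=> _ [n Nn <-]; exact: cN.
Qed.

Lemma inf_translate_sublinear : sublinear (inf_translate p N).
Proof.
split=> [x y|t x t0].
- suff H n : N n -> inf_translate p N (x + y) - inf_translate p N y
      <= p (x + n.1) - n.2.
    by have := le_inf_translate H; lra.
  move=> Nn; suff : inf_translate p N (x + y) - (p (x + n.1) - n.2)
      <= inf_translate p N y by lra.
  apply: le_inf_translate => m Nm.
  have := inf_translate_le (x + y) (ND Nn Nm); rewrite /= addrACA.
  have := sp.1 (x + n.1) (y + m.1); lra.
- rewrite -ler_pdivrMl//; apply: le_inf_translate => n Nn.
  rewrite ler_pdivrMl// (le_trans (inf_translate_le _ (NZ t0 Nn)))//=.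
  by rewrite -scalerDr mulrBr lerD2r; exact: sp.2.
Qed.

End InfTranslate.

Section MinimalSublinear.
Variable q : V -> R.
Hypothesis sq : sublinear q.

Let T := {p : V -> R | sublinear p /\ forall x, p x <= q x}.
Let ge_sub (p p' : T) := `[< forall x, sval p' x <= sval p x >].

(** Zorn's lemma for the reversed pointwise order. A chain is bounded by its pointwise infimum,
    which is finite because p <= q implies p x >= - q (- x). *)
Lemma minimal_sublinear : exists p, [/\ sublinear p, forall x, p x <= q x &
  forall p', sublinear p' -> (forall x, p' x <= p x) -> p' = p].
Proof.
have [|p1 p2 p3 /asboolP h /asboolP h'|p1 p2 /asboolP h /asboolP h'|A Atot|] :=
  @Zorn T ge_sub.
- by move=> t; apply/asboolP.
- by apply/asboolP => x; exact: le_trans (h' x) (h x).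
- case: p1 p2 h h' => [p1 ?] [p2 ?] /= h h'; apply: eq_exist.
  by apply/funext => x; apply/eqP; rewrite eq_le h h'.
- have [[a0 Aa0]|A0] := pselect (A !=set0); last first.
    exists (exist _ q (conj sq (fun x => lexx (q x)))) => s As.
    by case: A0; exists s.
  pose r x := inf [set sval p x | p in A].
  have rle (p : T) x : A p -> r x <= sval p x.
    move=> Ap; apply: ge_inf; last by exists p.
    exists (- q (- x)) => _ [[p' [sp' p'q]] _ <-] /=.
    by rewrite (le_trans _ (sublinear_ge _ sp'))// lerN2.
  have ler' c x : (forall p : T, A p -> c <= sval p x) -> c <= r x.
    move=> cA; apply: lb_le_inf; first by exists (sval a0 x), a0.
    by move=> _ [p Ap <-]; exact: cA.
  have sr : sublinear r.
    split=> [x y|t x t0].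
    (* Subadditivity of the infimum: of two members of the chain, the smaller one serves at both x
       and y. *)
    + suff H (p : T) : A p -> r (x + y) - r y <= sval p x by have := ler' _ _ H; lra.
      move=> Ap; suff : r (x + y) - sval p x <= r y by lra.
      apply: ler' => p' Ap'.
      have [/asboolP pp|/asboolP pp] := Atot _ _ Ap Ap'.
      * have := rle _ (x + y) Ap'; have := (svalP p').1.1 x y; have := pp x; lra.
      * have := rle _ (x + y) Ap; have := (svalP p).1.1 x y; have := pp y; lra.
    + rewrite -ler_pdivrMl//; apply: ler' => p Ap.
      rewrite ler_pdivrMl// (le_trans (rle _ _ Ap))//.
      exact: (svalP p).1.2.
  have rq x : r x <= q x := le_trans (rle _ x Aa0) ((svalP a0).2 x).
  by exists (exist _ r (conj sr rq)) => s As; apply/asboolP => x; exact: rle.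
- move=> [p [sp pq]] pmin; exists p; split=> // p' sp' p'p.
  have p'q x : p' x <= q x := le_trans (p'p x) (pq x).
  by have /(congr1 sval) := pmin (exist _ p' (conj sp' p'q)) (asboolT p'p).
Qed.

End MinimalSublinear.

(* A pointwise minimal sublinear functional p is additive: for fixed h, the
   sublinear functional v |-> inf_(t >= 0) (p (v + t h) - t p h) lies below p,
   hence equals p. *)
Lemma hahn_banach q : sublinear q ->
  exists phi : V -> R^o, linear phi /\ forall x, phi x <= q x.
Proof.
move=> sq; have [p [sp pq pmin]] := minimal_sublinear sq.
exists p; split => //.
have pD v h : p (v + h) = p v + p h.
  pose N : set (V * R) := [set n | exists2 t, 0 <= t & n = (t *: h, t * p h)].
  have N0 : N (0, 0) by exists 0; rewrite ?scale0r ?mul0r.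
  have N1 : N (h, p h) by exists 1; rewrite ?scale1r ?mul1r.
  have ND n m : N n -> N m -> N (n.1 + m.1, n.2 + m.2).
    move=> [t t0 ->] [s s0 ->]; exists (t + s); first exact: addr_ge0.
    by rewrite scalerDl mulrDl.
  have NZ t n : 0 < t -> N n -> N (t *: n.1, t * n.2).
    move=> t0 [s s0 ->]; exists (t * s); first by rewrite mulr_ge0// ltW.
    by rewrite scalerA mulrA.
  have Np n : N n -> n.2 <= p n.1.
    move=> [t t0 ->] /=; move: t0; rewrite le_eqVlt => /predU1P[<-|t0].
      by rewrite scale0r mul0r sublinear0.
    by rewrite sublinearZ.
  have le v' : inf_translate p N v' <= p v'.
    by have := inf_translate_le sp Np v' N0; rewrite addr0 subr0.
  have := pmin _ (inf_translate_sublinear sp N0 ND NZ Np) le.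
  move=> /(congr1 (@^~ v)) /= pv.
  have := inf_translate_le sp Np v N1; rewrite pv /=.
  have := sp.1 v h; lra.
have pN v : p (- v) = - p v.
  by apply/eqP; rewrite -addr_eq0 -pD addNr sublinear0.
move=> a u v; rewrite pD; congr (_ + _).
case: (ltgtP a 0) => [a0|a0|->].
- by rewrite -[a in LHS]opprK scaleNr pN sublinearZ ?oppr_gt0// mulNr opprK.
- by rewrite sublinearZ.
- by rewrite !scale0r sublinear0.
Qed.

(** Hahn-Banach for [inf_translate q N]: the pair (0, 0) gives phi <= q, and evaluation at - n.1
    gives the lower bound at n.1. *)
Lemma mazur_orlicz q N : sublinear q -> N (0, 0) ->
  (forall n m, N n -> N m -> N (n.1 + m.1, n.2 + m.2)) ->
  (forall t n, 0 < t -> N n -> N (t *: n.1, t * n.2)) ->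
  (forall n, N n -> n.2 <= q n.1) ->
  exists phi : V -> R^o, [/\ linear phi, forall x, phi x <= q x &
    forall n, N n -> n.2 <= phi n.1].
Proof.
move=> sq N0 ND NZ Nq.
have [phi [lphi phiq]] := hahn_banach (inf_translate_sublinear sq N0 ND NZ Nq).
exists phi; split => // [x|n Nn].
  by rewrite (le_trans (phiq x))// (le_trans (inf_translate_le sq Nq _ N0))//=
    addr0 subr0.
rewrite -lerN2 -(linfN lphi) (le_trans (phiq _))//
  (le_trans (inf_translate_le sq Nq _ Nn))//.
by rewrite addNr sublinear0// sub0r.
Qed.

End HahnBanach.

Section ContinuousLinear.
Context {R : realType} {V W : normedModType R} {f : V -> W}.
Hypothesis lf : linear f.

Let F : {linear V -> W} := HB.pack f (GRing.isLinear.Build _ _ _ _ f lf).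

Lemma linf_continuous M : (forall x, `|f x| <= M * `|x|) -> continuous f.
Proof.
move=> fM; apply: (bounded_linear_continuous (f := F)).
apply/linear_boundedP; exists M; split; first exact: num_real.
by move=> r Mr x; rewrite (le_trans (fM x))// ler_wpM2r// ltW.
Qed.

Lemma linf_bounded : continuous f ->
  exists2 M, 0 < M & forall x, `|f x| <= M * `|x|.
Proof.
move=> cf; have /linear_boundedP : bounded_near F (nbhs 0).
  by apply: continuous_linear_bounded; exact: cf.
by move=> /pinfty_ex_gt0[M M0 fM]; exists M.
Qed.

End ContinuousLinear.

Definition convex {R : realType} {V : lmodType R} (C : set V) : Prop :=
  forall (x y : V) (t : R), C x -> C y -> 0 <= t <= 1 ->
    C (t *: x + (1 - t) *: y).

Lemma convex_setE (R : realType) (V : lmodType R) (C : set V) :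
  convex_set (C : set (convex_lmodType V)) <-> convex C.
Proof.
split=> [cC x y t Cx Cy /andP[t0 t1]|cC x y t].
  by have := cC x y (Itv01 t0 t1); rewrite !inE; exact.
rewrite !inE => Cx Cy; have [t0 t1] : 0 <= t%:num /\ t%:num <= (1 : R).
  by split.
by have := cC x y t%:num Cx Cy; rewrite t0 t1 => /(_ isT).
Qed.

Section Separation.
Context {R : realType} {Y : normedModType R}.

(* Mazur-Orlicz for the norm and the cone generated by C x {d}. *)
Lemma separation (C : set Y) (d : R) : C !=set0 -> convex C ->
  (forall c, C c -> d <= `|c|) ->
  exists phi : Y -> R^o, [/\ dual phi, forall c, C c -> d <= phi c &
    forall y, `|phi y| <= `|y|].
Proof.
move=> [c0 Cc0] cC Cd.
pose N : set (Y * R) :=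
  [set n | exists t c, [/\ 0 <= t, C c & n = (t *: c, t * d)]].
have N0 : N (0, 0) by exists 0, c0; rewrite scale0r mul0r.
have normS : sublinear (fun y : Y => `|y|).
  split; first exact: ler_normD.
  by move=> t x t0; rewrite normrZ gtr0_norm.
have [n m|t n|n|phi [lphi phile Nphi]] := mazur_orlicz normS N0.
- move=> [t [c [t0 Cc ->]]] [s [e [s0 Ce ->]]] /=.
  have [ts|ts] := eqVneq (t + s) 0.
    have [-> ->] : t = 0 /\ s = 0 by split; lra.
    by rewrite !scale0r !mul0r !addr0.
  have ts0 : 0 < t + s by rewrite lt_neqAle eq_sym ts addr_ge0.
  exists (t + s), (t / (t + s) *: c + (1 - t / (t + s)) *: e); split.
  + exact: addr_ge0.
  + apply: cC => //; rewrite divr_ge0 ?addr_ge0//=.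
    by rewrite ler_pdivrMr// mul1r lerDl.
  + rewrite scalerDr !scalerA; congr pair; last by ring.
    by congr (_ *: _ + _ *: _); field.
- move=> t0 [s [c [s0 Cc ->]]]; exists (t * s), c; split => //.
    by rewrite mulr_ge0// ltW.
  by rewrite scalerA mulrA.
- by move=> [t [c [t0 Cc ->]]] /=; rewrite normrZ ger0_norm// ler_wpM2l// Cd.
have phin y : `|phi y| <= `|y|.
  rewrite ler_norml phile andbT lerNl -(linfN lphi).
  by rewrite (le_trans (phile _))// normrN.
exists phi; split => //.
  split => //; apply: (linf_continuous (M := 1) lphi) => x.
  by rewrite mul1r.
move=> c Cc; have : N (c, d) by exists 1, c; rewrite scale1r mul1r.
by move=> /Nphi.
Qed.

(** Separating the singleton of x - y from 0 yields a form whose value at x - y is at least the norm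
    of x - y. *)
Lemma linear_form_eq (x y : Y) :
  (forall phi : Y -> R, linear (phi : Y -> R^o) -> phi x = phi y) -> x = y.
Proof.
move=> xy; apply/eqP; rewrite -subr_eq0 -normr_eq0 eq_le normr_ge0 andbT.
have [||c ->//|phi [dphi phiC _]] := @separation [set x - y] `|x - y|.
- by exists (x - y).
- move=> _ _ t -> -> _ /=.
  by rewrite -scalerDl [t + _]addrC subrK scale1r.
- have := phiC _ erefl; rewrite (linfB dphi.1) (xy phi dphi.1).
  by rewrite subrr.
Qed.

(* The values are taken in R rather than R^o, so that ring recognizes the
   resulting expressions. *)
Lemma linear_formE (phi : Y -> R) : linear (phi : Y -> R^o) ->
  ((forall x y, phi (x + y)%R = (phi x + phi y)%R) *
   (forall x, phi (- x)%R = (- phi x)%R) *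
   (forall a x, phi (a *: x)%R = (a * phi x)%R) *
   (phi 0%R = 0%R))%type.
Proof.
move=> lphi; do !split => *;
  [exact: (linfD lphi)|exact: (linfN lphi)|exact: (linfZ lphi)|exact: (linf0 lphi)].
Qed.

End Separation.

(* Linear forms separate points, so an identity between vectors may be checked
   on the values of an arbitrary linear form, where it is one between scalars. *)
Ltac linear_forms :=
  let phi := fresh "phi" in let lphi := fresh "lphi" in
  apply: linear_form_eq => phi lphi;
  rewrite ?(linear_formE lphi).
Ltac module := linear_forms; ring.
Ltac module_field := linear_forms; field.

(** * Functionals nonnegative on a cone *)

Section ConeSeparation.
Context {R : realType} {Y : normedModType R}.

Definition dual_cone (K : set Y) : set (Y -> R^o) :=
  [set phi | dual phi /\ forall y, K y -> 0 <= phi y].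

Lemma not_closure_dist (C : set Y) y : ~ closure C y ->
  exists2 d : R, 0 < d & forall c, C c -> d <= `|c - y|.
Proof.
move=> Cy; apply: contrapT => h; apply: Cy => B /nbhs_ballP[e /= e0 eB].
apply: contrapT => BC; apply: h; exists e => // c Cc; rewrite leNgt.
apply/negP => ce; apply: BC; exists c; split => //; apply: eB.
by rewrite -ball_normE /= distrC.
Qed.

(** A functional of norm at most 1 separates K - y from 0 by the distance of y to K. The
    quantitative bound is kept because [separating_sequence] perturbs y. *)
Lemma cone_separation (K : set Y) y : convex_cone K -> K 0 ->
  exists phi, [/\ dual_cone K phi, forall z, `|phi z| <= `|z| &
    forall d, (forall c, K c -> d <= `|c - y|) -> phi y <= - d].
Proof.
move=> [KD KZ] K0; pose E := [set `|c - y| | c in K]; pose d0 := inf E.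
have E0 : has_lbound E by exists 0 => _ [c Kc <-].
have [||_ [c Kc <-]|phi [dphi phiC phin]] :=
  @separation _ _ [set c - y | c in K] d0.
- by exists (0 - y), 0.
- move=> _ _ t [a Ka <-] [b Kb <-] /andP[t0 t1].
  exists (t *: a + (1 - t) *: b).
    by apply: KD; apply: KZ => //; rewrite subr_ge0.
  by module.
- by apply: ge_inf => //; exists c.
have lphi := dphi.1.
exists phi; split => //; last first.
  move=> d Kd; have := phiC _ (ex_intro2 _ _ 0 K0 erefl).
  rewrite sub0r (linfN lphi).
  have : d <= d0.
    by apply: lb_le_inf; [exists `|0 - y|, 0|move=> _ [c Kc <-]; exact: Kd].
  by lra.
split => // z Kz; rewrite leNgt; apply/negP => phiz.
(* scaling z up would make phi unbounded below on K - y *)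
have t0 : 0 <= (1 + `|d0| + `|phi y|) / - phi z.
  by rewrite divr_ge0 ?addr_ge0// oppr_ge0 ltW.
have := phiC _ (ex_intro2 _ _ _ (KZ _ _ t0 Kz) erefl).
rewrite (linfB lphi) (linfZ lphi) [_ *: _]mulrC invrN mulrN mulrN mulrCA divff.
  have := ler_norm (- phi y); have := ler_norm (- d0); rewrite !normrN; lra.
by rewrite lt_eqF.
Qed.

Lemma closed_cone_separation (K : set Y) y : closed K -> convex_cone K ->
  K 0 -> ~ K y -> exists2 phi, dual_cone K phi & phi y < 0.
Proof.
move=> clK cK K0 Ky.
have /not_closure_dist[d d0 Kd] : ~ closure K y by move=> /clK.
have [phi [Kphi _ phiy]] := cone_separation y cK K0.
by exists phi => //; have := phiy d Kd; lra.
Qed.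

(** With s dense, phi n separates - s n from K. If y in K is not 0, then - y has a distance d > 0 to
    K; for s n within d / 2 of y, phi n (- s n) <= - d / 2, and a functional of norm at most 1
    cannot then vanish at y. *)
Lemma separating_sequence (K : set Y) : separable_space Y -> closed K ->
  convex_cone K -> K 0 -> (forall y, K y -> K (- y) -> y = 0) ->
  exists phi : nat -> Y -> R^o, (forall n, dual_cone K (phi n)) /\
    forall y, K y -> (forall n, phi n y = 0) -> y = 0.
Proof.
move=> /separable_sequence[s sd] clK cK K0 Kpt.
have [phi phiP] := choice (fun n => cone_separation (- s n) cK K0).
exists phi; split => [n|y Ky phiy]; first by have [] := phiP n.
apply: contrapT => y0; have /not_closure_dist[d d0 Kd] : ~ closure K (- y).
  by move=> /clK /(Kpt _ Ky).
have d20 : 0 < d / 2 by rewrite divr_gt0.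
have [|z [yz [n _ snz]]] := sd (ball y (d / 2)) _ (ball_open _ _).
  by exists y; exact: ballxx.
move: yz; rewrite -snz -ball_normE /= => ysn.
have [[[lphi _] _] phin] := phiP n.
have : phi n (- s n) <= - (d / 2).
  have [] := phiP n => _ _; apply => c Kc.
  have := Kd c Kc; have -> : c - - y = c - - s n + (y - s n).
    by module.
  move=> /le_trans /(_ (ler_normD _ _)); lra.
have := phin (y - s n); rewrite (linfB lphi) phiy (linfN lphi) sub0r normrN.
have := ler_norm (phi n (s n)); lra.
Qed.

(** Separate the base from 0 by phi >= d; if M bounds the base in norm, then phi (l b) >= l d >= (d
    / M) |l b|. *)
Lemma bounded_base_dual (K : set Y) : has_bounded_base K ->
  exists phi c, [/\ dual_cone K phi, 0 < c &
    forall y, K y -> c * `|y| <= phi y].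
Proof.
move=> [B [/convex_setE cB BK KB B0] bB].
have [d d0 Bd] := not_closure_dist B0.
have [Bn0|/set0P/negP/negPn/eqP B_0] := pselect (B !=set0); last first.
  (* An empty base generates the empty cone, on which every estimate holds. *)
  exists (fun=> 0), 1; split => //.
    split => //; split; last exact: cst_continuous.
    by move=> a u v; rewrite scaler0 addr0.
  by move=> y; rewrite KB => -[l [b []]]; rewrite B_0.
have [c Bc|phi [dphi phiB _]] := @separation _ _ B d Bn0 cB.
  by have := Bd c Bc; rewrite subr0.
have lphi := dphi.1.
have [M M0 BM] : exists2 M, 0 < M & forall b, B b -> `|b| <= M.
  by case/pinfty_ex_gt0 : bB => M M0 BM; exists M.
have K_phi y : K y -> d / M * `|y| <= phi y.
  rewrite KB => -[l [b [l0 Bb ->]]]; rewrite normrZ ger0_norm// (linfZ lphi).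
  rewrite [leRHS]/(l * phi b) mulrCA ler_wpM2l// (le_trans _ (phiB _ Bb))//.
  by rewrite -mulrA ler_piMr ?(ltW d0)// ler_pdivrMl// mulr1 BM.
exists phi, (d / M); split => //; last by rewrite divr_gt0.
split => // y Ky; rewrite (le_trans _ (K_phi _ Ky))// mulr_ge0//.
by rewrite divr_ge0 ?ltW.
Qed.

End ConeSeparation.

(** * Norm convergence of order-monotone families *)

(** In a compact interval an ultrafilter has a cluster point, and it converges to each of its
    cluster points. *)
Lemma ultra_bounded_cvg (R : realType) (T : Type) (U : set_system T)
    (h : T -> R) B : UltraFilter U ->
  (\forall t \near U, `|h t| <= B) -> exists l : R, h @ U --> l.
Proof.
move=> UU hB; have := @segment_compact R (- B) B.
have hUB : (h @ U) `[- B, B]%classic.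
  by apply: filterS hB => t; rewrite /= in_itv/= ler_norml.
case/(_ _ (fmap_proper_filter h _) hUB) => l [_ hl]; exists l => A lA.
have [//|UA] := in_ultra_setVsetC (h @^-1` A) UU.
by have [z [nAz /nAz]] := hl (~` A) A UA lA.
Qed.

Lemma cvg_le (R : realType) (T : Type) (F : set_system T) (h : T -> R)
    (l B : R) :
  ProperFilter F -> h @ F --> l -> (\forall t \near F, h t <= B) -> l <= B.
Proof.
move=> FF hl hB; have <- : lim (h @ F) = l by exact: cvg_lim.
by apply: limr_le => //; apply/cvg_ex; exists l.
Qed.

Lemma cvg_ge (R : realType) (T : Type) (F : set_system T) (h : T -> R)
    (l B : R) :
  ProperFilter F -> h @ F --> l -> (\forall t \near F, B <= h t) -> B <= l.
Proof.
move=> FF hl hB; have <- : lim (h @ F) = l by exact: cvg_lim.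
by apply: limr_ge => //; apply/cvg_ex; exists l.
Qed.

Lemma dual_normP (R : realType) (Y : normedModType R) (phi : Y -> R^o) y :
  dual phi -> `|phi y| <= dual_norm phi * `|y|.
Proof.
move=> [lphi cphi]; have [M M0 phiM] := linf_bounded lphi cphi.
have [->|y0] := eqVneq y 0; first by rewrite (linf0 lphi) !normr0 mulr0.
have ny : 0 < `|y| by rewrite normr_gt0.
rewrite -ler_pdivrMr//; apply: ub_le_sup.
  exists M => _ [z /= z1 <-]; rewrite (le_trans (phiM z))//.
  by rewrite ler_piMr// ltW.
exists (`|y|^-1 *: y); first by rewrite /= normrZ normfV normr_id mulVf ?gt_eqF.
by rewrite (linfZ lphi) normrZ normfV normr_id mulrC.
Qed.

Lemma dual_norm_ge0 (R : realType) (Y : normedModType R) (phi : Y -> R^o) :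
  dual phi -> 0 <= dual_norm phi.
Proof.
move=> [lphi cphi]; have [M M0 phiM] := linf_bounded lphi cphi.
apply: ub_le_sup; last by exists 0; rewrite /= ?normr0// (linf0 lphi) normr0.
exists M => _ [z /= z1 <-]; rewrite (le_trans (phiM z))//.
by rewrite ler_piMr// ltW.
Qed.

Section MonotoneConvergence.
Context {R : realType} {Y : normedModType R} {K : set Y} {k : Y}.
Hypotheses (reflY : reflexive_space Y) (clK : closed K) (coneK : convex_cone K).
Hypotheses (normK : normal_cone K) (kK : K k).

(** The limits along [U] of all continuous functionals define a bidual element bounded by M, which
    reflexivity turns into a point of [Y]. *)
Lemma ultra_weak_limit (T : Type) (U : set_system T) (D : T -> Y) M :
  UltraFilter U -> (\forall t \near U, `|D t| <= M) ->
  exists y, forall phi : Y -> R^o, dual phi -> phi (D t) @[t --> U] --> phi y.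
Proof.
move=> UU DM; pose Phi (phi : Y -> R^o) : R := lim (phi (D t) @[t --> U]).
have cvgPhi (phi : Y -> R^o) : dual phi -> phi (D t) @[t --> U] --> Phi phi.
  move=> dphi.
  have [|l phil] := @ultra_bounded_cvg R _ U (phi \o D) (dual_norm phi * M) UU.
    apply: filterS DM => t DM; rewrite (le_trans (dual_normP _ dphi))//.
    by rewrite ler_wpM2l// dual_norm_ge0.
  by apply/cvg_ex; exists l.
have [|y Phiy] := reflY (Phi := Phi); last first.
  by exists y => phi dphi; rewrite -Phiy//; exact: cvgPhi.
split=> [a phi psi dphi dpsi|].
  apply: cvg_lim => //; apply: cvgD; last exact: cvgPhi.
  by apply: cvgMr; exact: cvgPhi.
exists M => phi dphi; apply: (@cvg_le R _ U (fun t => `|phi (D t)|)).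
  by apply: cvg_norm; exact: cvgPhi.
apply: filterS DM => t DM; rewrite (le_trans (dual_normP _ dphi))// mulrC.
by rewrite ler_wpM2r// dual_norm_ge0.
Qed.

(** As t decreases to 0, D decreases up to a multiple of k. A weak ultrafilter limit y lies below D
    t + e t k, since K is weakly closed; by Mazur, some z near y in norm lies above D t - r k for
    small t. Normality squeezes D t between the two. *)
Lemma almost_monotone_cvg (D : R -> Y) (e : R -> R) (t0 M : R) : 0 < t0 ->
  (forall s t : R, 0 < s -> s < t -> t < t0 -> K (D t + e t *: k - D s)) ->
  (forall t : R, 0 < t -> t < t0 -> `|D t| <= M) ->
  e t @[t --> 0^'+] --> 0 -> cvg (D t @[t --> 0^'+]).
Proof.
move=> t00 Dmon DM e0; have [KD KZ] := coneK.
have K0 : K 0 by rewrite -(scale0r k); exact: KZ.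
have [U [UU sU]] := ultraFilterLemma (at_right_proper_filter (0 : R)).
have near0 (r : R) : 0 < r -> \forall t \near (0 : R)^'+, 0 < t /\ t < r.
  move=> r0; near=> t; split; first by near: t; exact: nbhs_right_gt.
  by near: t; exact: nbhs_right_lt.
have [|y Uy] := @ultra_weak_limit _ U D M UU.
  by apply: sU; apply: filterS (near0 _ t00) => t [] /DM; exact.
have ley t : 0 < t -> t < t0 -> K (D t + e t *: k - y).
  move=> tp tt0; apply: contrapT.
  move=> /(closed_cone_separation clK coneK K0)[phi [dphi Kphi]].
  have lphi := dphi.1; rewrite (linfB lphi) subr_lt0; apply/negP; rewrite -leNgt.
  apply: (@cvg_le R _ U (fun s => phi (D s)) _ _ _ (Uy _ dphi)).
  apply: sU; apply: filterS (near0 _ tp) => s [s0 st].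
  by rewrite -subr_ge0 -(linfB lphi); apply: Kphi; exact: Dmon.
(* [C r] holds the points that bound D from above near 0 up to r k; it is convex and, for r > 0,
   contains D t for all small t. *)
pose C r : set Y :=
  [set z | exists2 s0 : R, 0 < s0 &
    forall s : R, 0 < s -> s < s0 -> K (z + r *: k - D s)].
have DC r : 0 < r -> \forall t \near (0 : R)^'+, C r (D t).
  move=> r0; near=> t; exists t; first by near: t; exact: nbhs_right_gt.
  move=> s s0 st; have -> : D t + r *: k - D s =
      (D t + e t *: k - D s) + (r - e t) *: k.
    by module.
  apply: KD; first by apply: Dmon => //; near: t; exact: nbhs_right_lt.
  apply: KZ => //; rewrite subr_ge0 ltW//; near: t.
  exact: cvgr_lt e0 _ r0.
(* Mazur: otherwise C r would be strictly separated from y, although D tends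
   weakly to y along U *)
have yC r : 0 < r -> exists2 z, C r z & `|z - y| < r.
  move=> r0; apply: contrapT => h.
  have [||_ [c Cc <-]|phi [dphi phiC _]] := @separation _ _ [set c - y | c in C r] r.
  - have [z Cz] : exists z, C r z.
      have [t Ct] := @filter_ex _ _ (at_right_proper_filter (0 : R)) _ (DC _ r0).
      by exists (D t).
    by exists (z - y), z.
  - move=> _ _ t [a [s1 s10 Ca] <-] [b [s2 s20 Cb] <-] /andP[t0' t1].
    exists (t *: a + (1 - t) *: b); last first.
      by module.
    exists (Num.min s1 s2); first by rewrite lt_min s10.
    move=> s s0; rewrite lt_min => /andP[ss1 ss2].
    have -> : t *: a + (1 - t) *: b + r *: k - D s =
        t *: (a + r *: k - D s) + (1 - t) *: (b + r *: k - D s).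
      by module.
    by apply: KD; apply: KZ; rewrite ?subr_ge0//; [apply: Ca|apply: Cb].
  - by rewrite leNgt; apply/negP => cr; apply: h; exists c.
  have lphi := dphi.1; suff : phi y + r <= phi y by rewrite gerDl leNgt r0.
  apply: (@cvg_ge R _ U (fun s => phi (D s)) _ _ _ (Uy _ dphi)).
  apply: sU; apply: filterS (DC _ r0) => t Ct.
  have := phiC _ (ex_intro2 _ _ _ Ct erefl); rewrite (linfB lphi).
  by rewrite lerBrDl.
have [g g0 Kg] := normK.
apply/cvg_ex; exists y; apply/cvgrPdist_le => n n0.
(* The final error is g r (1 + 2 |k|) from normality plus r |k| from e t k, that is c r; hence r = n
   / c below. *)
pose c := g * (1 + 2 * `|k|) + `|k|.
have c0 : 0 < c.
  by rewrite ltr_pwDl// mulr_gt0// ltr_pwDl// mulr_ge0.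
pose r := n / c; have r0 : 0 < r by rewrite divr_gt0.
have [z [s0 s00 Cz] zy] := yC _ r0.
near=> t.
have tp : 0 < t by near: t; exact: nbhs_right_gt.
have tt0 : t < t0 by near: t; exact: nbhs_right_lt.
have ts0 : t < s0 by near: t; exact: nbhs_right_lt.
have etr : `|e t| <= r.
  near: t; move/cvgrPdist_le : e0 => /(_ r r0).
  by apply: filterS => t; rewrite sub0r normrN.
have etk : `|e t *: k| <= r * `|k| by rewrite normrZ ler_wpM2r.
pose u := D t + e t *: k - y; pose v := z + r *: k + e t *: k - y.
have uv : `|u| <= g * `|v|.
  apply: Kg; rewrite /cone_le ?subr0; first exact: ley.
  have -> : v - u = z + r *: k - D t by rewrite /u /v; module.
  exact: Cz.
have vr : `|v| <= r * (1 + 2 * `|k|).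
  have -> : v = (z - y) + r *: k + e t *: k.
    by rewrite /v; module.
  have := ler_normD (z - y + r *: k) (e t *: k).
  have := ler_normD (z - y) (r *: k); rewrite [`|r *: k|]normrZ (gtr0_norm r0).
  by move: zy etk; nra.
have -> : y - D t = e t *: k - u.
  by rewrite /u; module.
rewrite (le_trans (ler_normB _ _))//.
have -> : n = r * `|k| + g * (r * (1 + 2 * `|k|)).
  rewrite /r /c; field.
  by rewrite gt_eqF.
by rewrite lerD// (le_trans uv)// ler_wpM2l// ltW.
Unshelve. all: by end_near. Qed.

End MonotoneConvergence.

(** * Differentiability of paraconvex maps *)

(** Each doubling of the scale multiplies the lower bound by 4, so the second difference at scale t0
    would be at least 2 ^ n e t0 for every n. *)
Lemma no_kink (R : realType) (G : R -> R) (e t0 : R) : 0 < e -> 0 < t0 ->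
  (forall s t : R, `|s| <= t0 -> 0 < t -> t <= t0 ->
    e * t <= G (s + t) + G (s - t) - 2 * G s) -> False.
Proof.
move=> e0 t00 Ge; pose A s t := G (s + t) + G (s - t) - 2 * G s.
(* A s (2t) = A (s + t) t + A (s - t) t + 2 A s t, so doubling t multiplies
   the lower bound by 4 *)
have HA n (s t : R) : 0 < t -> `|s| + 2 ^+ n * t <= t0 ->
    4 ^+ n * (e * t) <= A s (2 ^+ n * t).
  elim: n s t => [|n IH] s t tp.
    rewrite !expr0 !mul1r => st; apply: Ge => //.
      by rewrite (le_trans _ st)// lerDl ltW.
    by rewrite (le_trans _ st)// lerDr.
  rewrite [2 ^+ _]exprS [4 ^+ _]exprS; set T := 2 ^+ n * t => st.
  have T0 : 0 < T by rewrite mulr_gt0// exprn_gt0.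
  have sT : `|s| + 2 * T <= t0 by rewrite mulrA.
  have -> : A s (2 * 2 ^+ n * t) = A (s + T) T + A (s - T) T + 2 * A s T.
    rewrite -mulrA -/T /A.
    have -> : s + T + T = s + 2 * T by ring.
    have -> : s - T - T = s - 2 * T by ring.
    rewrite addrK subrK; ring.
  have h1 : 4 ^+ n * (e * t) <= A (s + T) T.
    by apply: IH => //; have := ler_normD s T; rewrite (gtr0_norm T0) -/T; lra.
  have h2 : 4 ^+ n * (e * t) <= A (s - T) T.
    by apply: IH => //; have := ler_normB s T; rewrite (gtr0_norm T0) -/T; lra.
  have h3 : 4 ^+ n * (e * t) <= A s T by apply: IH => //; rewrite -/T; lra.
  lra.
pose n := (Num.trunc (`|A 0 t0| / (e * t0))).+1.
have nA : `|A 0 t0| / (e * t0) < n%:R by exact: truncnS_gt.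
have n2 : n%:R <= 2 ^+ n :> R by rewrite -natrX ler_nat ltnW// ltn_expl.
have p2 : (0 : R) < 2 ^+ n by rewrite exprn_gt0.
have E : 2 ^+ n * (t0 / 2 ^+ n) = t0 by field; rewrite gt_eqF.
have := HA n 0 (t0 / 2 ^+ n).
rewrite normr0 add0r E divr_gt0// lexx => /(_ isT isT).
have -> : 4 ^+ n = 2 ^+ n * 2 ^+ n :> R.
  by rewrite -exprMn; congr (_ ^+ _); ring.
have -> : 2 ^+ n * 2 ^+ n * (e * (t0 / 2 ^+ n)) = 2 ^+ n * (e * t0).
  by field; rewrite gt_eqF.
move: nA; rewrite ltr_pdivrMr ?mulr_gt0// => nA.
have : n%:R * (e * t0) <= 2 ^+ n * (e * t0) by rewrite ler_pM2r// mulr_gt0.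
have := ler_norm (A 0 t0); lra.
Qed.

(** Subadditivity and the bound by L make s Lipschitz, and sublinearity makes it convex. xi is its
    Frechet derivative at v0, of which only the upper estimate is kept. *)
Lemma asplund_sublinear (R : realType) (X : completeNormedModType R)
    (s : X -> R) (L : R) : asplund X -> sublinear s ->
  (forall v, s v <= L * `|v|) ->
  exists v0 (xi : X -> R^o), linear xi /\ forall e, 0 < e ->
    exists2 d, 0 < d & forall w, `|w| <= d ->
      s (v0 + w) <= s v0 + xi w + e * `|w|.
Proof.
move=> aspX ss sL.
have slip u v : `|s u - s v| <= L * `|u - v|.
  rewrite ler_norml; apply/andP; split.
    have := ss.1 u (v - u); rewrite addrC subrK.
    have := sL (v - u); rewrite distrC; lra.
  have := ss.1 v (u - v); rewrite addrC subrK.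
  have := sL (u - v); lra.
have cs : continuous (s : X -> R^o).
  move=> x; apply/cvgrPdist_le => e e0.
  have L1 : 0 < `|L| + 1 by rewrite ltr_wpDl.
  near=> y; rewrite (le_trans (slip x y))//.
  have : `|x - y| < e / (`|L| + 1).
    near: y; apply: (@cvgr_dist_lt _ _ _ (nbhs x) _ id x cvg_id).
    by rewrite divr_gt0.
  rewrite ltr_pdivlMr// => xy.
  have := ler_norm L; have := normr_ge0 (x - y); nra.
have [|| |G [_ _ clG Gdiff]] := aspX setT (s : X -> R^o) openT.
- by apply/convex_setE.
- exact: continuous_subspaceT.
- move=> t x y _ _; have [t0 t1] : 0 <= t%:num /\ t%:num <= (1 : R) by split.
  have sZ a v : 0 <= a -> s (a *: v) = a * s v.
    rewrite le_eqVlt => /predU1P[<-|a0]; last by rewrite sublinearZ.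
    by rewrite scale0r mul0r sublinear0.
  apply: le_trans (ss.1 _ _) _.
  by rewrite !sZ// subr_ge0.
have [v0 [Gv0 _]] := clG 0 I setT filterT.
have /diff_locally dv0 := Gdiff v0 Gv0.
exists v0, ('d (s : X -> R^o) v0); split; first exact: linearP.
move=> e e0; move/eqaddoP : dv0 => /(_ e e0) /nbhs_ballP[d /= d0 dP].
exists (d / 2); first by rewrite divr_gt0.
move=> w wd; have /dP : ball (0 : X) d w.
  rewrite -ball_normE /= sub0r normrN (le_lt_trans wd)//; lra.
have -> : v0 + w = w + v0 by rewrite addrC.
move=> /(le_trans (ler_norm _)); set xw := 'd _ _ w.
rewrite -[X in X <= _]/(s (w + v0) - (s v0 + xw)); lra.
Unshelve. all: by end_near. Qed.

Section RightLimits.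
Context {R : realType} {Y : normedModType R}.
Implicit Types (g : R -> Y) (l : Y).

Lemma cvg_right0P g l : g t @[t --> 0^'+] --> l <->
  forall e, 0 < e -> exists2 d, 0 < d &
    forall t, 0 < t -> t < d -> `|l - g t| <= e.
Proof.
split=> [/cvgrPdist_le gl e e0|gl].
  have [d /= d0 dgl] := gl e e0; exists d => // t t0 td.
  by apply: dgl => //=; rewrite sub0r normrN gtr0_norm.
apply/cvgrPdist_le => e /gl[d d0 dgl]; near=> t; apply: dgl.
  by near: t; exact: nbhs_right_gt.
by near: t; exact: nbhs_right_lt.
Unshelve. all: by end_near. Qed.

Lemma cvg_right0_scale g l c : 0 < c ->
  g t @[t --> 0^'+] --> l -> g (c * t) @[t --> 0^'+] --> l.
Proof.
move=> c0 /cvg_right0P gl; apply/cvg_right0P => e /gl[d d0 dgl].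
exists (d / c); first exact: divr_gt0.
by move=> t t0 td; apply: dgl; rewrite ?mulr_gt0// mulrC -ltr_pdivlMr.
Qed.

Lemma cvg_right0_closed (K : set Y) g l d : closed K -> 0 < d ->
  (forall t, 0 < t -> t < d -> K (g t)) ->
  g t @[t --> 0^'+] --> l -> K l.
Proof.
move=> clK d0 Kg; apply: closed_cvg => //; near=> t; apply: Kg.
  by near: t; exact: nbhs_right_gt.
by near: t; exact: nbhs_right_lt.
Unshelve. all: by end_near. Qed.

End RightLimits.

(** * The modulus alpha near 0 *)

Section Modulus.
Context {R : realType} {alpha : R -> R}.
Hypotheses (alpha_ge0 : forall t : R, 0 <= t -> 0 <= alpha t)
  (alpha_nd : forall s t : R, 0 <= s -> s <= t -> alpha s <= alpha t)
  (alpha_lim : alpha t / t @[t --> 0^'+] --> (0 : R)).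

Lemma alpha_small e : 0 < e -> exists2 d, 0 < d &
  forall t, 0 <= t -> t < d -> alpha t <= e * t.
Proof.
move=> e0; have /(@cvg_right0P _ R^o)/(_ e e0)[d d0 de] := alpha_lim.
have small t : 0 < t -> t < d -> alpha t <= e * t.
  move=> t0 td; rewrite -ler_pdivrMr//; have := de t t0 td.
  by rewrite sub0r normrN => /(le_trans (ler_norm _)).
exists d => // t; rewrite le_eqVlt => /predU1P[<- _|]; last exact: small.
(* The limit does not see t = 0, but monotonicity gives alpha 0 <= alpha s <= e s for small s > 0,
   whereas the s chosen below has e s <= alpha 0 / 2. *)
rewrite mulr0 leNgt; apply/negP => a0.
pose s := Num.min (d / 2) (alpha 0 / (2 * e)).
have s0 : 0 < s by rewrite lt_min !divr_gt0// mulr_gt0.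
have sd : s < d by rewrite gt_min ltr_pdivrMr// mulr_natr mulr2n ltrDl d0.
have se : s * (2 * e) <= alpha 0.
  by rewrite -ler_pdivlMr ?mulr_gt0// ge_min lexx orbT.
have := alpha_nd (lexx 0) (ltW s0); have := small _ s0 sd; lra.
Qed.

Lemma alpha_scale_cvg c : 0 <= c -> alpha (t * c) / t @[t --> 0^'+] --> (0 : R).
Proof.
move=> c0; apply/(@cvg_right0P _ R^o) => e e0.
have c1 : 0 < c + 1 by rewrite ltr_wpDl.
have [d d0 small] := alpha_small (divr_gt0 e0 c1).
exists (d / (c + 1)); first exact: divr_gt0.
move=> t t0; rewrite ltr_pdivlMr// => td.
rewrite sub0r normrN ger0_norm ?divr_ge0 ?alpha_ge0 ?mulr_ge0 ?(ltW t0)//.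
have tc0 : 0 <= t * c by rewrite mulr_ge0// ltW.
have /(small _ tc0) : t * c < d by nra.
rewrite ler_pdivrMr// => /le_trans; apply.
have -> : e / (c + 1) * (t * c) = (e * t) * (c / (c + 1)) by field; rewrite gt_eqF.
by rewrite ler_piMr ?mulr_ge0 ?(ltW e0) ?(ltW t0)// ler_pdivrMr// mul1r lerDl.
Qed.

End Modulus.

(** * Order estimates and Lipschitz bounds for paraconvex maps *)

Section Paraconvex.
Context {R : realType} {X : completeNormedModType R} {Y : normedModType R}.
Context {alpha : R -> R} {K : set Y} {k : Y} {Omega : set X} {f : X -> Y} {C : R}.
Hypotheses (alpha_ge0 : forall t : R, 0 <= t -> 0 <= alpha t)
  (alpha_nd : forall s t : R, 0 <= s -> s <= t -> alpha s <= alpha t)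
  (alpha_lim : alpha t / t @[t --> 0^'+] --> (0 : R)).
Hypotheses (reflY : reflexive_space Y) (clK : closed K)
  (coneK : convex_cone K) (normK : normal_cone K) (kK : K k).
Hypotheses (openO : open Omega) (cf : {within Omega, continuous f}) (C0 : 0 < C).
Hypothesis paraf : forall (x y : X) (l : R), Omega x -> Omega y ->
  0 <= l <= 1 ->
  cone_le K (f (l *: x + (1 - l) *: y))
    (l *: f x + (1 - l) *: f y + (C * Num.min l (1 - l) * alpha `|x - y|) *: k).

Lemma coneD x y : K x -> K y -> K (x + y). Proof. exact: coneK.1. Qed.

Lemma coneZ l x : 0 <= l -> K x -> K (l *: x). Proof. exact: coneK.2. Qed.

Lemma cone_pointed y : K y -> K (- y) -> y = 0.
Proof.
move=> Ky KNy; have [g g0 Kg] := normK.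
have := Kg y 0; rewrite /cone_le subr0 sub0r normr0 mulr0 => /(_ Ky KNy).
by rewrite normr_le0 => /eqP.
Qed.

(** Replacing the minimum by l and alpha |x - y| by an upper bound a only adds a nonnegative
    multiple of k. Later uses of paraconvexity go through this form. *)
Lemma paraconvex_le x y l a : Omega x -> Omega y -> 0 <= l <= 1 ->
  alpha `|x - y| <= a ->
  K (l *: f x + (1 - l) *: f y + (C * l * a) *: k - f (l *: x + (1 - l) *: y)).
Proof.
move=> Ox Oy /andP[l0 l1] ale.
have -> : l *: f x + (1 - l) *: f y + (C * l * a) *: k -
    f (l *: x + (1 - l) *: y) =
  (l *: f x + (1 - l) *: f y + (C * Num.min l (1 - l) * alpha `|x - y|) *: k
    - f (l *: x + (1 - l) *: y)) +
  (C * (l * a - Num.min l (1 - l) * alpha `|x - y|)) *: k by module.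
apply: coneD; first by apply: paraf => //; rewrite l0.
apply: coneZ => //; rewrite mulr_ge0 ?(ltW C0)// subr_ge0.
by rewrite ler_pM ?le_min ?subr_ge0 ?l0 ?alpha_ge0// ge_min lexx.
Qed.

Lemma continuous_Omega x : Omega x -> {for x, continuous f}.
Proof.
move=> Ox; move: cf; rewrite continuous_open_subspace// => /(_ x); apply.
exact/mem_set.
Qed.

Lemma locally_bounded x : Omega x -> exists r M, 0 < r /\
  forall y, `|y - x| <= r -> Omega y /\ `|f y| <= M.
Proof.
move=> Ox; have fx := continuous_Omega Ox.
have : \forall y \near x, Omega y /\ `|f y| <= `|f x| + 1.
  near=> y; split; first by near: y; exact: open_nbhs_nbhs.
  rewrite -lerBlDl (le_trans (lerB_dist _ _))// distrC; near: y.
  by move/cvgrPdist_le : fx; apply.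
case/nbhs_ballP => e /= e0 xe; exists (e / 2), (`|f x| + 1).
split=> [|y ye]; first exact: divr_gt0.
apply: xe; rewrite -ball_normE /= distrC (le_lt_trans ye)//.
by rewrite ltr_pdivrMr// mulr_natr mulr2n ltrDl.
Unshelve. all: by end_near. Qed.

(** Paraconvexity between x and a point beyond x + h bounds the increment from above; between x + h
    and a point behind x it bounds it from below. Normality turns these order bounds into a norm
    bound. L depends on r and M but not on x. *)
Lemma paraconvex_lipschitz r M : 0 < r -> exists2 L, 0 <= L &
  forall x h, (forall y, `|y - x| <= r -> Omega y /\ `|f y| <= M) ->
    `|h| <= r -> `|f (x + h) - f x| <= L * `|h|.
Proof.
move=> r0; have [g g0 Kg] := normK; pose c := C * alpha (2 * r).
have c0 : 0 <= c by rewrite mulr_ge0 ?(ltW C0)// alpha_ge0// mulr_ge0// ltW.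
pose B := (`|M| + `|M| + c * `|k|).
have B0 : 0 <= B by rewrite !addr_ge0// mulr_ge0.
exists ((1 + 2 * g) * (B / r)).
  by rewrite mulr_ge0 ?divr_ge0 ?(ltW r0)// addr_ge0// mulr_ge0// ltW.
move=> x h xr hr; have [->|hn0] := eqVneq h 0.
  by rewrite addr0 subrr !normr0 mulr0.
pose s := `|h|; have s0 : 0 < s by rewrite normr_gt0.
pose u := x + (r / s) *: h; pose v := x - (r / s) *: h.
have rsh : `|(r / s) *: h| = r.
  by rewrite normrZ -/s gtr0_norm ?divr_gt0// divfK// gt_eqF.
have [Ou fu] : Omega u /\ `|f u| <= M.
  by apply: xr; rewrite /u addrAC subrr add0r rsh.
have [Ov fv] : Omega v /\ `|f v| <= M.
  by apply: xr; rewrite /v addrAC subrr add0r normrN rsh.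
have [Ox fx] : Omega x /\ `|f x| <= M.
  by apply: xr; rewrite subrr normr0 ltW.
have [Oxh fxh] : Omega (x + h) /\ `|f (x + h)| <= M.
  by apply: xr; rewrite addrAC subrr add0r.
have alphar t : 0 <= t -> t <= 2 * r -> alpha t <= alpha (2 * r).
  exact: alpha_nd.
pose l := s / r; have l0 : 0 < l by rewrite divr_gt0.
pose b := l *: (f u - f x + c *: k).
pose a := - (l *: (f v - f x + c *: k)).
have Kb : K (b - (f (x + h) - f x)).
  have -> : b - (f (x + h) - f x) = l *: f u + (1 - l) *: f x +
      (C * l * alpha (2 * r)) *: k - f (l *: u + (1 - l) *: x).
    have -> : l *: u + (1 - l) *: x = x + h.
      by rewrite /u /l; module_field; rewrite !gt_eqF.
    by rewrite /b /c; module.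
  apply: paraconvex_le => //.
    by rewrite (ltW l0)/= /l ler_pdivrMr// mul1r.
  apply: alphar => //; rewrite /u addrAC subrr add0r rsh.
  by rewrite mulr_natl mulr2n lerDl ltW.
have Ka : K (f (x + h) - f x - a).
  (* This weight makes x the convex combination m v + (1 - m) (x + h). *)
  pose m := s / (r + s); have rs0 : 0 < r + s by rewrite addr_gt0.
  have -> : f (x + h) - f x - a = (1 + l) *: (m *: f v + (1 - m) *: f (x + h) +
      (C * m * alpha (2 * r)) *: k - f (m *: v + (1 - m) *: (x + h))).
    have -> : m *: v + (1 - m) *: (x + h) = x.
      by rewrite /v /m; module_field; rewrite !gt_eqF.
    by rewrite /a /m /l /c; module_field; rewrite !gt_eqF.
  apply: coneZ; first by rewrite addr_ge0// ltW.
  apply: paraconvex_le => //.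
    by rewrite divr_ge0 ?(ltW s0) ?(ltW rs0)//= ler_pdivrMr// mul1r lerDr ltW.
  apply: alphar => //.
  have -> : v - (x + h) = - ((r / s) *: h + h) by rewrite /v; module.
  rewrite normrN (le_trans (ler_normD _ _))// rsh mulr_natl mulr2n.
  by rewrite lerD2l.
have nb (w : Y) : `|w| <= M -> `|l *: (w - f x + c *: k)| <= l * B.
  move=> wM; rewrite normrZ gtr0_norm// ler_pM2l//.
  rewrite (le_trans (ler_normD _ _))// normrZ ger0_norm// lerD2r.
  rewrite (le_trans (ler_normB _ _))// lerD//.
    exact: le_trans wM (ler_norm _).
  exact: le_trans fx (ler_norm _).
have na : `|a| <= l * B by rewrite /a normrN nb.
have da : `|f (x + h) - f x - a| <= g * `|b - a|.
  apply: Kg; rewrite /cone_le ?subr0//.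
  by have -> : b - a - (f (x + h) - f x - a) = b - (f (x + h) - f x) by module.
have -> : f (x + h) - f x = (f (x + h) - f x - a) + a by rewrite subrK.
rewrite (le_trans (ler_normD _ _))//.
have ba : `|b - a| <= l * B + l * B.
  by rewrite (le_trans (ler_normB _ _))// lerD// nb.
have -> : (1 + 2 * g) * (B / r) * `|h| = g * (l * B + l * B) + l * B.
  by rewrite /l -/s; field; rewrite gt_eqF.
by rewrite lerD// (le_trans da)// ler_pM2l.
Qed.

(** * One-sided directional derivatives *)

Definition diff_quot (x h : X) (t : R) : Y := t^-1 *: (f (x + t *: h) - f x).

(** x + s h is the convex combination of x + t h and x with weight s / t; the paraconvexity estimate
    is divided by s. *)
Lemma diff_quot_mono x h s t : 0 < s -> s < t -> Omega x -> Omega (x + t *: h) ->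
  K (diff_quot x h t + (C * (alpha (t * `|h|) / t)) *: k - diff_quot x h s).
Proof.
move=> s0 st Ox Oxt; have t0 : 0 < t := lt_trans s0 st.
have -> :
    diff_quot x h t + (C * (alpha (t * `|h|) / t)) *: k - diff_quot x h s =
    s^-1 *: ((s / t) *: f (x + t *: h) + (1 - s / t) *: f x +
      (C * (s / t) * alpha (t * `|h|)) *: k -
      f ((s / t) *: (x + t *: h) + (1 - s / t) *: x)).
  have -> : (s / t) *: (x + t *: h) + (1 - s / t) *: x = x + s *: h.
    by module_field; rewrite gt_eqF.
  by rewrite /diff_quot; module_field; rewrite !gt_eqF.
apply: coneZ; first by rewrite invr_ge0 ltW.
apply: paraconvex_le => //.
  by rewrite divr_ge0 ?(ltW s0) ?(ltW t0)//= ler_pdivrMr// mul1r ltW.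
by rewrite addrAC subrr add0r normrZ gtr0_norm.
Qed.

Lemma open_dir x h : Omega x -> exists2 d, 0 < d &
  forall t, 0 <= t -> t < d -> Omega (x + t *: h) /\ Omega (x - t *: h).
Proof.
move=> /locally_bounded[r [M [r0 xr]]].
(* The summand 1 covers h = 0, here and in later choices of radii. *)
exists (r / (`|h| + 1)); first by rewrite divr_gt0// ltr_wpDl.
move=> t t0; rewrite ltr_pdivlMr ?ltr_wpDl// => td.
have th : `|t *: h| <= r.
  by rewrite normrZ ger0_norm// (le_trans _ (ltW td))// ler_wpM2l// lerDl.
split.
  by apply: (xr _ _).1; rewrite addrAC subrr add0r.
by apply: (xr _ _).1; rewrite addrAC subrr add0r normrN.
Qed.

Definition rderiv (x h : X) : Y := lim (diff_quot x h t @[t --> 0^'+]).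

Lemma diff_quot_error_cvg (h : X) :
  C * (alpha (t * `|h|) / t) @[t --> 0^'+] --> (0 : R).
Proof. by rewrite -[X in _ --> X](mulr0 C); apply: cvgMr; apply: alpha_scale_cvg. Qed.

Lemma rderiv_cvg x h : Omega x -> diff_quot x h t @[t --> 0^'+] --> rderiv x h.
Proof.
move=> Ox; have [d d0 xd] := open_dir h Ox.
have [r [M [r0 xr]]] := locally_bounded Ox.
have [L L0 lip] := paraconvex_lipschitz M r0.
have h1 : 0 < `|h| + 1 by rewrite ltr_wpDl.
apply: (@almost_monotone_cvg _ _ K k reflY clK coneK normK kK (diff_quot x h)
  (fun t => C * (alpha (t * `|h|) / t)) (Num.min d (r / (`|h| + 1))) (L * `|h|)).
- by rewrite lt_min d0 divr_gt0.
- move=> s t s0 st; rewrite lt_min => /andP[td _]; apply: diff_quot_mono => //.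
  by apply: (xd _ _ _).1 => //; rewrite ltW// (lt_trans s0).
- move=> t t0; rewrite lt_min => /andP[td].
  rewrite ltr_pdivlMr// => tr.
  have th : `|t *: h| <= r.
    by rewrite normrZ gtr0_norm// (le_trans _ (ltW tr))// ler_pM2l// lerDl.
  rewrite /diff_quot normrZ normfV gtr0_norm// ler_pdivrMl//.
  by rewrite (le_trans (lip _ _ xr th))// normrZ gtr0_norm// mulrCA.
- exact: diff_quot_error_cvg.
Qed.

Lemma rderiv_unique x h l : Omega x ->
  diff_quot x h t @[t --> 0^'+] --> l -> rderiv x h = l.
Proof. by move=> Ox; apply: cvg_lim. Qed.

Lemma rderiv_le x h t : 0 < t -> Omega x -> Omega (x + t *: h) ->
  K (diff_quot x h t + (C * (alpha (t * `|h|) / t)) *: k - rderiv x h).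
Proof.
move=> t0 Ox Oxt.
apply: (cvg_right0_closed clK t0
  (g := fun s =>
    diff_quot x h t + (C * (alpha (t * `|h|) / t)) *: k - diff_quot x h s)).
  by move=> s s0 st; exact: diff_quot_mono.
by apply: cvgB; [exact: cvg_cst|exact: rderiv_cvg].
Qed.

Lemma rderivZ x h c : 0 < c -> Omega x -> rderiv x (c *: h) = c *: rderiv x h.
Proof.
move=> c0 Ox; apply: rderiv_unique => //.
have -> : diff_quot x (c *: h) = (fun t => c *: diff_quot x h (c * t)).
  apply/funext => t; rewrite /diff_quot !scalerA [t * c]mulrC invfM mulrA divff ?mul1r//.
  by rewrite gt_eqF.
by apply: cvgZr; apply: cvg_right0_scale => //; exact: rderiv_cvg.
Qed.

Lemma rderiv0 x : Omega x -> rderiv x 0 = 0.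
Proof.
move=> Ox; apply: rderiv_unique => //.
have -> : diff_quot x 0 = fun=> 0; last exact: cvg_cst.
by apply/funext => t; rewrite /diff_quot scaler0 addr0 subrr scaler0.
Qed.

(** x + t (h + h') is the midpoint of x + 2 t h and x + 2 t h', and the error term vanishes with
    t. *)
Lemma rderivD x h h' : Omega x -> K (rderiv x h + rderiv x h' - rderiv x (h + h')).
Proof.
move=> Ox; have [d d0 xd] := open_dir h Ox; have [d' d'0 xd'] := open_dir h' Ox.
have t20 : (0 : R) < 2 by [].
pose g t := diff_quot x h (2 * t) + diff_quot x h' (2 * t) +
  (C * (alpha (2 * t * `|h - h'|) / (2 * t))) *: k - diff_quot x (h + h') t.
apply: (cvg_right0_closed (g := g) (d := Num.min d d' / 2) clK).
- by rewrite divr_gt0// lt_min d0.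
- move=> t t0; rewrite ltr_pdivlMr// lt_min mulrC => /andP[td td'].
  have -> : g t = t^-1 *: (2^-1 *: f (x + (2 * t) *: h) +
      (1 - 2^-1) *: f (x + (2 * t) *: h') +
      (C * 2^-1 * alpha (2 * t * `|h - h'|)) *: k -
      f (2^-1 *: (x + (2 * t) *: h) + (1 - 2^-1) *: (x + (2 * t) *: h'))).
    have -> : 2^-1 *: (x + (2 * t) *: h) + (1 - 2^-1) *: (x + (2 * t) *: h') =
        x + t *: (h + h') by module_field.
    by rewrite /g /diff_quot; module_field; rewrite gt_eqF.
  apply: coneZ; first by rewrite invr_ge0 ltW.
  have tt : 0 <= 2 * t by rewrite mulr_ge0// ltW.
  apply: paraconvex_le.
  + by apply: (xd _ _ _).1.
  + by apply: (xd' _ _ _).1.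
  + lra.
  + have -> : x + (2 * t) *: h - (x + (2 * t) *: h') = (2 * t) *: (h - h').
      by module.
    by rewrite normrZ ger0_norm.
- apply: cvgB; last exact: rderiv_cvg.
  rewrite -[_ + rderiv x h']addr0 -(scale0r k).
  apply: cvgD; last first.
    apply: cvgZl; apply: (cvg_right0_scale (Y := R^o)
      (g := fun t => C * (alpha (t * `|h - h'|) / t)) t20).
    exact: diff_quot_error_cvg.
  by apply: cvgD; apply: cvg_right0_scale => //; exact: rderiv_cvg.
Qed.

Lemma rderiv_pair x h : Omega x -> K (rderiv x h + rderiv x (- h)).
Proof. by move=> Ox; have := rderivD h (- h) Ox; rewrite subrr rderiv0// subr0. Qed.

Lemma rderiv_norm x h L r : Omega x -> 0 < r ->
  (forall w, `|w| <= r -> `|f (x + w) - f x| <= L * `|w|) ->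
  `|rderiv x h| <= L * `|h|.
Proof.
move=> Ox r0 lip; have h1 : 0 < `|h| + 1 by rewrite ltr_wpDl.
have nd : `|diff_quot x h t| @[t --> 0^'+] --> `|rderiv x h|.
  by apply: cvg_norm; exact: rderiv_cvg.
apply: (cvg_le _ nd); near=> t.
have t0 : 0 < t by near: t; exact: nbhs_right_gt.
have : t < r / (`|h| + 1) by near: t; apply: nbhs_right_lt; rewrite divr_gt0.
rewrite ltr_pdivlMr// => tr.
have th : `|t *: h| <= r.
  by rewrite normrZ gtr0_norm// (le_trans _ (ltW tr))// ler_pM2l// lerDl.
rewrite /diff_quot normrZ normfV gtr0_norm// ler_pdivrMl//.
by rewrite (le_trans (lip _ th))// normrZ gtr0_norm// mulrCA.
Unshelve. all: by end_near. Qed.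

Lemma rderiv_bounded x : Omega x -> exists2 L, 0 <= L &
  forall h, `|rderiv x h| <= L * `|h|.
Proof.
move=> Ox; have [r [M [r0 xr]]] := locally_bounded Ox.
have [L L0 lip] := paraconvex_lipschitz M r0.
exists L => // h; apply: (rderiv_norm _ Ox r0) => w wr; exact: lip.
Qed.

(** Subadditivity at (u, v) and at (- u, - v) puts the defect of additivity in K and in - K, so it
    is 0. *)
Lemma rderiv_linear x : Omega x ->
  (forall h, rderiv x h + rderiv x (- h) = 0) ->
  linear (rderiv x).
Proof.
move=> Ox rderivN.
have rderivNE h : rderiv x (- h) = - rderiv x h.
  by apply/eqP; rewrite -addr_eq0 addrC rderivN.
move=> a u v.
have -> : rderiv x (a *: u + v) = rderiv x (a *: u) + rderiv x v.
  apply/esym/eqP; rewrite -subr_eq0; apply/eqP; apply: cone_pointed.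
    exact: rderivD.
  have := rderivD (- (a *: u)) (- v) Ox; rewrite -opprD !rderivNE.
  have -> // : - rderiv x (a *: u) - rderiv x v - - rderiv x (a *: u + v) =
    - (rderiv x (a *: u) + rderiv x v - rderiv x (a *: u + v)) by module.
congr (_ + _); case: (ltgtP a 0) => [a0|a0|->].
- by rewrite -[a in LHS]opprK scaleNr rderivNE rderivZ ?oppr_gt0// scaleNr opprK.
- exact: rderivZ.
- by rewrite !scale0r rderiv0.
Qed.

(* By sublinearity, the even part of rderiv x is Lipschitz. *)
Lemma rderiv_pair_dense (H : set X) x : Omega x -> dense H ->
  (forall h, H h -> rderiv x h + rderiv x (- h) = 0) ->
  forall h, rderiv x h + rderiv x (- h) = 0.
Proof.
move=> Ox dH rderivH h; have [g g0 Kg] := normK.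
have [L L0 rderivL] := rderiv_bounded Ox.
apply/eqP; rewrite -normr_le0; apply/ler_addgt0Pr => e e0; rewrite add0r.
have gL : 0 < g * (2 * L) + 1 by rewrite ltr_wpDl// !mulr_ge0// ltW.
have := dH (ball h (e / (g * (2 * L) + 1))) _ (ball_open _ _).
case; first by exists h; apply: ballxx; rewrite divr_gt0.
move=> h' [+ Hh']; rewrite -ball_normE /= ltr_pdivlMr// => hh'.
have : `|rderiv x h + rderiv x (- h)| <=
    g * `|rderiv x (h - h') + rderiv x (h' - h)|.
  apply: Kg; rewrite /cone_le ?subr0; first exact: rderiv_pair.
  have := coneD (rderivD h' (h - h') Ox) (rderivD (- h') (h' - h) Ox).
  have -> : h' + (h - h') = h by module.
  have -> : - h' + (h' - h) = - h by module.
  have := rderivH _ Hh' => E.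
  have -> : rderiv x h' + rderiv x (h - h') - rderiv x h +
     (rderiv x (- h') + rderiv x (h' - h) - rderiv x (- h)) =
     (rderiv x h' + rderiv x (- h')) +
     (rderiv x (h - h') + rderiv x (h' - h) - (rderiv x h + rderiv x (- h))) by module.
  by rewrite E add0r.
move=> /le_trans; apply.
have := rderivL (h - h'); have := rderivL (h' - h); rewrite (distrC h' h) => d1 d2.
have := ler_normD (rderiv x (h - h')) (rderiv x (h' - h)).
set A := `|_ + _|; set z := `|h - h'| in hh' d1 d2 * => d3.
have z0 : 0 <= z by rewrite normr_ge0.
have : g * A <= g * (L * z + L * z) by rewrite ler_pM2l//; lra.
nra.
Qed.

(** * Second differences and Gateaux differentiability *)

Definition second_diff (x w : X) : Y := f (x + w) + f (x - w) - 2 *: f x.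

(** The sum of [rderiv_le] for h and - h. It controls the even part of the derivative by the values
    of f at three points, a quantity continuous in x. *)
Lemma rderiv_pair_le x h t : 0 < t -> Omega x -> Omega (x + t *: h) ->
  Omega (x - t *: h) ->
  K (t^-1 *: second_diff x (t *: h) + (2 * C * (alpha (t * `|h|) / t)) *: k
     - (rderiv x h + rderiv x (- h))).
Proof.
move=> t0 Ox Oxp Oxm.
have := coneD (rderiv_le t0 Ox Oxp) (rderiv_le (h := - h) t0 Ox _).
rewrite scalerN normrN => /(_ Oxm).
set B := (X in _ -> K X); set A := (X in K X); have -> // : A = B.
by rewrite /A /B /diff_quot /second_diff scalerN; module.
Qed.

Lemma cvg_shift x w : Omega (x + w) -> f (y + w) @[y --> x] --> f (x + w).
Proof.
move=> Oxw; apply: (@cvg_comp _ _ _ (fun y => y + w) f _ (nbhs (x + w))).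
  by apply: cvgD; [exact: cvg_id|exact: cvg_cst].
exact: continuous_Omega.
Qed.

Lemma near_shift x w : Omega (x + w) -> \forall y \near x, Omega (y + w).
Proof.
move=> Oxw; have /= := @cvgD _ _ _ _ _ id (fun=> w) x w cvg_id (cvg_cst w).
by apply; exact: open_nbhs_nbhs.
Qed.

(** A small second difference at a single scale t is an open condition and, by [rderiv_pair_le],
    bounds the even part. Its density comes from [no_kink] on a line in direction h. *)
Lemma rderiv_pair_generic phi h : dual_cone K phi ->
  on_dense_Gdelta Omega (fun x => phi (rderiv x h + rderiv x (- h)) = 0).
Proof.
move=> [[lphi cphi] Kphi].
pose O n : set X := [set x | exists t : R,
  [/\ [/\ 0 < t, Omega x, Omega (x + t *: h) & Omega (x - t *: h)],
  alpha (t * `|h|) <= n.+1%:R^-1 * t &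
  phi (second_diff x (t *: h)) < n.+1%:R^-1 * t]].
apply: (on_dense_Gdelta_impl _ (on_dense_Gdelta_bigcap openO (O := O) _ _)).
- move=> x Ox xO; apply/eqP; rewrite eq_le Kphi ?andbT; last exact: rderiv_pair.
  apply/ler_addgt0Pr => e e0; rewrite add0r.
  pose c := 1 + 2 * C * phi k.
  have c0 : 0 < c by rewrite ltr_pwDl// !mulr_ge0 ?Kphi// ltW.
  have [n nP] : exists n, n.+1%:R^-1 * c <= e.
    exists (Num.trunc (c / e)); have : c / e < (Num.trunc (c / e)).+1%:R.
      exact: truncnS_gt.
    by rewrite ltr_pdivrMr// => /ltW h'; rewrite ler_pdivrMl.
  have [t [[t0 _ Op Om] at_ ht]] := xO n.
  have := Kphi _ (rderiv_pair_le t0 Ox Op Om).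
  rewrite (linfB lphi) (linfD lphi) !(linfZ lphi) subr_ge0 => /le_trans; apply.
  apply: le_trans nP; rewrite /c mulrDr mulr1; apply: lerD.
    by rewrite [leLHS]/(t^-1 * _) ler_pdivrMl// mulrC ltW.
  rewrite [leLHS]/(_ * phi k).
  have ->: n.+1%:R^-1 * (2 * C * phi k) = 2 * C * n.+1%:R^-1 * phi k by ring.
  rewrite ler_wpM2r ?Kphi// ler_wpM2l ?mulr_ge0 ?(ltW C0)//.
  by rewrite ler_pdivrMr.
- move=> n; rewrite openE => x [t [[t0 Ox Op Om] at_ ht]].
  rewrite /interior; near=> y; exists t; split => //; last first.
    near: y.
    have cc : phi (second_diff y (t *: h)) @[y --> x] -->
        phi (second_diff x (t *: h)).
      apply: (@cvg_comp _ _ _ (fun y => second_diff y (t *: h)) phi _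
        (nbhs (second_diff x (t *: h)))); last exact: cphi.
      apply: cvgB; last by apply: cvgZr; exact: continuous_Omega.
      by apply: cvgD; exact: cvg_shift.
    exact: cvgr_lt cc _ ht.
  split => //; near: y; first exact: open_nbhs_nbhs.
    exact: near_shift.
  exact: near_shift.
- move=> n x Ox B /nbhs_ballP[b /= b0 bB].
  pose e : R := n.+1%:R^-1; have e0 : 0 < e by rewrite invr_gt0.
  have [r [M [r0 xr]]] := locally_bounded Ox.
  have h1 : 0 < `|h| + 1 by rewrite ltr_wpDl.
  have [d d0 ad] := alpha_small alpha_nd alpha_lim (divr_gt0 e0 h1).
  (* Displacements up to m stay in the given neighbourhood, in [Omega] and in the range where alpha
     is small; t0 keeps s h below m for |s| <= 2 t0, the reach of s + t and s - t. *)
  pose m := Num.min (b / 2) (Num.min (r / 2) d).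
  have m0 : 0 < m by rewrite !lt_min d0 !divr_gt0.
  pose t0 := m / (`|h| + 1) / 2.
  have t00 : 0 < t0 by rewrite !divr_gt0.
  have sm s : `|s| <= 2 * t0 -> `|s *: h| <= m.
    move=> st; rewrite normrZ (@le_trans _ _ (2 * t0 * (`|h| + 1)))//.
      by rewrite ler_pM// lerDl.
    by rewrite /t0 mulrCA divff// mulr1 divfK// gt_eqF.
  have mb : m < b.
    have b2 : b / 2 < b by lra.
    by rewrite gt_min b2.
  have mr : m <= r.
    have r2 : r / 2 <= r by lra.
    by rewrite !ge_min r2 orbT.
  have md : m <= d by rewrite !ge_min lexx !orbT.
  have Os s : `|s| <= 2 * t0 -> Omega (x + s *: h).
    move=> /sm st; apply: (xr _ _).1.
    by rewrite addrAC subrr add0r (le_trans st).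
  apply: contrapT => noB.
  apply: (@no_kink R (fun s => phi (f (x + s *: h))) e t0 e0 t00).
  move=> s t st tp tt0; rewrite leNgt; apply/negP => ht; apply: noB.
  have sp : `|s + t| <= 2 * t0.
    by have := ler_normD s t; rewrite (gtr0_norm tp); lra.
  have sn : `|s - t| <= 2 * t0.
    by have := ler_normB s t; rewrite (gtr0_norm tp); lra.
  exists (x + s *: h); split; last first.
    apply: bB; rewrite -ball_normE /= opprD addrA subrr add0r normrN.
    by rewrite (le_lt_trans _ mb)// sm//; lra.
  have Ep : x + s *: h + t *: h = x + (s + t) *: h by module.
  have En : x + s *: h - t *: h = x + (s - t) *: h by module.
  exists t; split.
  + by rewrite Ep En; split => //; apply: Os => //; lra.
  + have tn : 0 <= t * `|h| by rewrite mulr_ge0// ltW.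
    have th : t * (`|h| + 1) < d.
      rewrite (lt_le_trans _ md)// -ltr_pdivlMr//.
      by rewrite (le_lt_trans tt0)// /t0 ltr_pdivrMr// mulr_natr mulr2n ltrDl divr_gt0.
    have := ad _ tn; rewrite -/e => /(_ _)/le_trans; apply; first by nra.
    have -> : e / (`|h| + 1) * (t * `|h|) = (e * t) * (`|h| / (`|h| + 1)).
      by field; rewrite gt_eqF.
    rewrite ler_piMr ?mulr_ge0 ?(ltW e0) ?(ltW tp)//.
    by rewrite ler_pdivrMr// mul1r lerDl.
  + by rewrite /second_diff Ep En (linfB lphi) (linfD lphi) (linfZ lphi).
Unshelve. all: by end_near. Qed.

(** For t < 0 the quotient in direction h is minus the right quotient in direction - h, so the left
    limit is - rderiv x (- h) = rderiv x h. *)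
Lemma gateaux_of_pair x : Omega x ->
  (forall h, rderiv x h + rderiv x (- h) = 0) ->
  gateaux_differentiable f x.
Proof.
move=> Ox rderivN; have ldd := rderiv_linear Ox rderivN.
have der h :
    (fun t => t^-1 *: ((f \o shift x) (t *: h) - f x)) @ 0^' --> rderiv x h.
  apply/cvgrPdist_le => e e0.
  have /cvg_right0P/(_ e e0)[d d0 pd] := rderiv_cvg (h := h) Ox.
  have /cvg_right0P/(_ e e0)[d' d'0 nd] := rderiv_cvg (h := - h) Ox.
  exists (Num.min d d'); first by rewrite /= lt_min d0.
  move=> t; rewrite /= sub0r normrN lt_min => /andP[td td'] tn0.
  rewrite [t *: h + x]addrC; case: (ltgtP t 0) => [t0|t0|t0].
  - rewrite ltr0_norm// in td'; have := nd (- t); rewrite oppr_gt0 => /(_ t0 td').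
    rewrite /diff_quot (linfN ldd) scaleNr scalerN opprK -normrN.
    rewrite [X in `|X|](_ : _ = rderiv x h - t^-1 *: (f (x + t *: h) - f x))//.
    by rewrite invrN scaleNr opprB opprK addrC.
  - by rewrite gtr0_norm// in td; exact: pd.
  - by rewrite t0 eqxx in tn0.
have derE h : 'D_h f x = rderiv x h by exact: cvg_lim (der h).
split.
- by move=> h; apply/cvg_ex; exists (rderiv x h); exact: der.
- by move=> a u v; rewrite !derE ldd.
- have -> : (fun h => 'D_h f x) = rderiv x by apply/funext => h; exact: derE.
  have [L L0 rderivL] := rderiv_bounded Ox.
  exact: linf_continuous ldd L rderivL.
Qed.

(** Countably many conditions suffice: the phi i separate the points of K from 0, and
    [rderiv_pair_dense] extends from a dense sequence of directions. *)
Lemma gateaux_generic : separable_space Y -> separable_space X ->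
  on_dense_Gdelta Omega (gateaux_differentiable f).
Proof.
move=> sepY /separable_sequence[h dh].
have K0 : K 0 by rewrite -(scale0r k); exact: coneZ.
have [phi [Kphi sphi]] := separating_sequence sepY clK coneK K0 cone_pointed.
have := on_dense_Gdelta_forall openO (fun i =>
  on_dense_Gdelta_forall openO (fun j => rderiv_pair_generic (h j) (Kphi i))).
apply: on_dense_Gdelta_impl => x Ox xphi; apply: gateaux_of_pair => //.
apply: (rderiv_pair_dense Ox dh) => _ [j _ <-]; apply: sphi; first exact: rderiv_pair.
by move=> i; exact: xphi.
Qed.

(** * A mean value inequality and Frechet differentiability *)

Lemma rderiv_le_increment phi x w (b e : R) : dual_cone K phi -> 0 < e ->
  Omega x -> Omega (x + w) ->
  (forall t : R, 0 <= t -> t <= 1 -> Omega (x + t *: w) /\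
     b <= phi (rderiv (x + t *: w) w)) ->
  b - e * `|w| <= phi (f (x + w)) - phi (f x).
Proof.
move=> [[lphi _] Kphi] e0 Ox Oxw bw.
pose c := 1 + C * phi k.
have c0 : 0 < c by rewrite ltr_pwDl// !mulr_ge0 ?Kphi// ltW.
have [d d0 ad] := alpha_small alpha_nd alpha_lim (divr_gt0 e0 c0).
pose N := (Num.trunc (`|w| / d)).+1.
have N0 : (0 : R) < N%:R by rewrite ltr0n.
have wN : `|w| / N%:R < d.
  rewrite ltr_pdivrMr// mulrC -ltr_pdivrMr//; exact: truncnS_gt.
pose i (j : nat) : R := j%:R / N%:R.
(* rderiv_le on each of the N subsegments; the errors add up to
   N alpha(|w|/N) *)
have step j : (j < N)%N ->
    (b - e * `|w|) / N%:R <= phi (f (x + i j.+1 *: w)) - phi (f (x + i j *: w)).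
  move=> jN; have i0 m : 0 <= i m by rewrite divr_ge0.
  have i1 m : (m <= N)%N -> i m <= 1.
    by move=> mN; rewrite ler_pdivrMr// mul1r ler_nat.
  have [Oj bj] := bw _ (i0 j) (i1 _ (ltnW jN)).
  have [Oj1 _] := bw _ (i0 j.+1) (i1 _ jN).
  have E : x + i j *: w + N%:R^-1 *: w = x + i j.+1 *: w.
    have -> : i j.+1 = i j + N%:R^-1 by rewrite /i -addn1 natrD mulrDl mul1r.
    by module.
  have Ni0 : (0 : R) < N%:R^-1 by rewrite invr_gt0.
  have := rderiv_le (h := w) Ni0 Oj; rewrite E => /(_ Oj1) /Kphi.
  rewrite /diff_quot !(linear_formE lphi) E => ddl.
  set A : R := phi (f (x + i j.+1 *: w)) - phi (f (x + i j *: w)).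
  have a1 : alpha (N%:R^-1 * `|w|) <= e / c * (N%:R^-1 * `|w|).
    by apply: ad; [rewrite mulr_ge0// ltW|rewrite mulrC].
  have a2 : C * alpha (N%:R^-1 * `|w|) * phi k <= e * `|w| / N%:R.
    have -> : C * alpha (N%:R^-1 * `|w|) * phi k =
        alpha (N%:R^-1 * `|w|) * (C * phi k) by ring.
    have Ck : 0 <= C * phi k by rewrite mulr_ge0 ?Kphi// ltW.
    apply: le_trans (ler_wpM2r Ck a1) _.
    have -> : e / c * (N%:R^-1 * `|w|) * (C * phi k) =
        (e * `|w| / N%:R) * (C * phi k / c) by field; rewrite !gt_eqF.
    rewrite ler_piMr ?mulr_ge0 ?invr_ge0 ?(ltW e0) ?(ltW N0)//.
    by rewrite ler_pdivrMr// mul1r lerDr.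
  rewrite ler_pdivrMr//.
  have : b <= N%:R * (A + C * alpha (N%:R^-1 * `|w|) * phi k).
    apply: (le_trans bj); rewrite -subr_ge0 (le_trans ddl)//.
    by rewrite le_eqVlt; apply/orP; left; apply/eqP; rewrite /A; field; rewrite gt_eqF.
  have : N%:R * (C * alpha (N%:R^-1 * `|w|) * phi k) <= e * `|w|.
    by move: a2; rewrite ler_pdivlMr// mulrC.
  lra.
have sum j : (j <= N)%N ->
    j%:R * ((b - e * `|w|) / N%:R) <= phi (f (x + i j *: w)) - phi (f x).
  elim: j => [|j IH] jN; first by rewrite /i !mul0r scale0r addr0 subrr.
  have := IH (ltnW jN); have := step j jN.
  rewrite -[j.+1%:R]natr1 (mulrDl j%:R) mul1r; lra.
have := sum N (leqnn _).
have -> : i N = 1 by rewrite /i divff// gt_eqF.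
by rewrite scale1r mulrC divfK// gt_eqF.
Qed.

(** A strict form, with increments between any two points of V: it passes to subsets, which makes
    the sets [W n] of [frechet_generic] open. *)
Definition near_linear (phi : Y -> R) (e : R) (V : set X) : Prop :=
  exists xi : X -> R^o, linear xi /\ forall y w, V y -> V (y + w) ->
    `|phi (f (y + w)) - phi (f y) - xi w| <= e * `|w|.

(* With s v the supremum of phi (rderiv x v) over a ball U and xi the
   derivative of s at v0, the points x of U with phi (rderiv x v0) close to s v0 satisfy
   phi (rderiv x w) >= xi w - e |w|. *)
Lemma near_linear_dense phi e x0 B : asplund X -> dual_cone K phi -> 0 < e ->
  Omega x0 -> nbhs x0 B -> exists x1 r, [/\ 0 < r, ball x1 r `<=` B `&` Omega &
    near_linear phi e (ball x1 r)].
Proof.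
move=> aspX Kphi' e0 Ox0 /nbhs_ballP[b /= b0 bB].
have [[lphi cphi] Kphi] := Kphi'.
have [r [M [r0 xr]]] := locally_bounded Ox0.
have r20 : 0 < r / 2 by rewrite divr_gt0.
have [L L0 lip] := paraconvex_lipschitz M r20.
(* Balls of radius r / 2 about points of [U] stay in the ball of radius r about x0, so L serves at
   all points of [U]. *)
pose m := Num.min b (r / 2); have m0 : 0 < m by rewrite lt_min b0.
have mr : m <= r / 2 by rewrite ge_min lexx orbT.
have mb : m <= b by rewrite ge_min lexx.
pose U := ball x0 m.
have Ur x : U x -> forall y, `|y - x| <= r / 2 -> Omega y /\ `|f y| <= M.
  rewrite /U -ball_normE /= distrC => xm y yx; apply: xr.
  have -> : y - x0 = (y - x) + (x - x0) by module.
  have := ler_normD (y - x) (x - x0); lra.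
have UO x : U x -> Omega x.
  by move=> /Ur h; apply: (h x _).1; rewrite subrr normr0 ltW.
have [P P0 phiP] := linf_bounded lphi cphi.
have rderivP x v : U x -> phi (rderiv x v) <= P * L * `|v|.
  move=> Ux; apply: (le_trans (ler_norm _)); apply: (le_trans (phiP _)).
  rewrite -mulrA ler_wpM2l ?(ltW P0)//.
  by apply: (rderiv_norm _ (UO _ Ux) r20) => w wr; apply: lip => //; exact: Ur.
pose s v := sup [set phi (rderiv x v) | x in U].
have Ux0 : U x0 by exact: ballxx.
have sle x v : U x -> phi (rderiv x v) <= s v.
  move=> Ux; apply: ub_le_sup; last by exists x.
  by exists (P * L * `|v|) => _ [y Uy <-]; exact: rderivP.
have les v c : (forall x, U x -> phi (rderiv x v) <= c) -> s v <= c.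
  move=> h; apply: ge_sup; first by exists (phi (rderiv x0 v)), x0.
  by move=> _ [y Uy <-]; exact: h.
have phiD x v w : U x -> phi (rderiv x (v + w)) <= phi (rderiv x v) + phi (rderiv x w).
  move=> Ux; have := Kphi _ (rderivD v w (UO _ Ux)).
  by rewrite (linfB lphi) (linfD lphi) subr_ge0.
have ss : sublinear s.
  split=> [v w|t v t0].
    apply: les => x Ux; apply: (le_trans (phiD _ _ _ Ux)).
    by rewrite lerD// sle.
  apply: les => x Ux; rewrite rderivZ//; last exact: UO.
  by rewrite (linfZ lphi) [leLHS]/(t * _) ler_pM2l// sle.
have [v0 [xi [lxi xiP]]] :=
  asplund_sublinear aspX ss (fun v => les v _ (fun x Ux => rderivP x v Ux)).
(* Two thirds of e go into the lower bound for the derivative, one third into its integration by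
   [rderiv_le_increment]. *)
pose q := e / 3; have q0 : 0 < q by rewrite divr_gt0.
have [d d0 dP] := xiP _ q0.
have qd0 : 0 < q * d by rewrite mulr_gt0.
have [x Ux sx] : exists2 x, U x & s v0 - q * d < phi (rderiv x v0).
  apply: contrapT => h; suff : s v0 <= s v0 - q * d by rewrite lerDl oppr_ge0 leNgt qd0.
  by apply: les => x Ux; rewrite leNgt; apply/negP => hx; apply: h; exists x.
have Ox := UO _ Ux.
pose F t y := phi (t^-1 *: (f y - f (y - t *: v0)) -
  (C * (alpha (t * `|v0|) / t)) *: k).
(* F t y is a lower bound of phi (rderiv y v0) that is continuous in y, so the
   points where the slice condition holds contain an open set *)
have Fle t y : 0 < t -> U y -> Omega (y - t *: v0) -> F t y <= phi (rderiv y v0).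
  move=> t0 Uy Oy; have Oy' := UO _ Uy.
  have := Kphi _ (rderiv_le (h := - v0) t0 Oy' _); rewrite scalerN normrN => /(_ Oy).
  have := Kphi _ (rderiv_pair v0 Oy').
  rewrite /F /diff_quot scalerN !(linear_formE lphi); nra.
(* At y = x + t v0 the backward quotient in [F t y] is the forward quotient at x, so [F t y] tends
   to phi (rderiv x v0). *)
have [t [t0 Ux1 Oxt Ft]] : exists t, [/\ 0 < t, U (x + t *: v0),
    Omega (x + t *: v0) & s v0 - q * d < F t (x + t *: v0)].
  have Fcvg : F t (x + t *: v0) @[t --> 0^'+] --> phi (rderiv x v0).
    have -> : (fun t => F t (x + t *: v0)) =
        (fun t => phi (diff_quot x v0 t) - phi ((C * (alpha (t * `|v0|) / t)) *: k)).
      by apply/funext => t; rewrite /F addrK (linfB lphi).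
    have -> : phi (rderiv x v0) = phi (rderiv x v0) - phi (0 *: k).
      by rewrite scale0r (linf0 lphi) subr0.
    have phic (T : R -> Y) l : T t @[t --> 0^'+] --> l ->
        phi (T t) @[t --> 0^'+] --> phi l.
      by move=> Tl; apply: (@cvg_comp _ _ _ T phi _ (nbhs l)) => //; exact: cphi.
    apply: (@cvgB _ R^o); first by apply: phic; exact: rderiv_cvg.
    by apply: phic; apply: cvgZl; exact: diff_quot_error_cvg.
  have Ucvg : \forall t \near (0 : R)^'+, U (x + t *: v0).
    have xt : x + t *: v0 @[t --> 0^'+] --> x.
      rewrite -[X in _ --> X]addr0 -(scale0r v0).
      apply: cvgD; first exact: cvg_cst.
      by apply: cvgZl; apply: cvg_at_right_filter; exact: cvg_id.
    by apply: xt; apply: open_nbhs_nbhs; split => //; exact: ball_open.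
  near (0 : R)^'+ => t; exists t; have Ut : U (x + t *: v0) by near: t.
  split => //; first exact: UO.
  by near: t; exact: cvgr_gt Fcvg _ sx.
set x1 := x + t *: v0 in Ux1 Oxt Ft.
have : \forall y \near x1, [/\ U y, Omega (y - t *: v0) & s v0 - q * d < F t y].
  have Fc : F t y @[y --> x1] --> F t x1.
    apply: (@cvg_comp _ _ _ (fun y => t^-1 *: (f y - f (y - t *: v0)) -
      (C * (alpha (t * `|v0|) / t)) *: k) phi _
      (nbhs (t^-1 *: (f x1 - f (x1 - t *: v0)) -
      (C * (alpha (t * `|v0|) / t)) *: k))); last exact: cphi.
    apply: cvgB; last exact: cvg_cst.
    apply: cvgZr; apply: cvgB; first exact: continuous_Omega.
    by apply: cvg_shift; rewrite /x1 addrK.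
  near=> y; split; near: y.
  - by apply: open_nbhs_nbhs; split => //; exact: ball_open.
  - by apply: near_shift; rewrite /x1 addrK.
  - exact: cvgr_gt Fc _ Ft.
move=> /nbhs_ballP[p /= p0 pP]; exists x1, p; split => //.
  move=> y /pP[Uy _ _]; split; last exact: UO.
  by apply: bB; apply: le_ball Uy.
exists xi; split => //.
have lower y w : ball x1 p y -> xi w - 2 * q * `|w| <= phi (rderiv y w).
  move=> /pP[Uy Oy Fy].
  (* By subadditivity phi (rderiv y (- u)) >= phi (rderiv y v0) - s (v0 + u); the slice condition
     and the expansion of s at v0 cost q d each. Homogeneity then reaches every w. *)
  have key u : `|u| = d -> - xi u - 2 * q * d <= phi (rderiv y (- u)).
    move=> ud; have ud' : `|u| <= d by rewrite ud.
    have := dP u ud'; rewrite ud => h1.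
    have := lt_le_trans Fy (Fle _ _ t0 Uy Oy).
    have := phiD y (v0 + u) (- u) Uy; rewrite addrK.
    have := sle _ (v0 + u) Uy; lra.
  have [->|w0] := eqVneq w 0.
    by rewrite rderiv0 ?(linf0 lphi) ?(linf0 lxi) ?normr0 ?mulr0 ?subr0//; exact: UO.
  have nw : 0 < `|w| by rewrite normr_gt0.
  have dw : 0 < d / `|w| by rewrite divr_gt0.
  have := key (- ((d / `|w|) *: w)).
  rewrite normrN normrZ gtr0_norm// divfK ?gt_eqF// => /(_ erefl).
  rewrite (linfN lxi) !opprK rderivZ//; last exact: UO.
  rewrite (linfZ lxi) (linfZ lphi).
  rewrite [X in X - _ <= _]/(_ * _) [X in _ <= X]/(_ * _) => h.
  rewrite -(ler_pM2l dw) (le_trans _ h)//.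
  have -> : d / `|w| * (xi w - 2 * q * `|w|) = d / `|w| * xi w - 2 * q * d.
    by field; rewrite gt_eqF.
  by [].
have half y w : ball x1 p y -> ball x1 p (y + w) ->
    xi w - e * `|w| <= phi (f (y + w)) - phi (f y).
  move=> yp ywp.
  have -> : xi w - e * `|w| = (xi w - 2 * q * `|w|) - q * `|w| by rewrite /q; field.
  have OV z : ball x1 p z -> Omega z by move=> /pP[/UO].
  apply: rderiv_le_increment => //; [exact: OV|exact: OV|].
  move=> a a0 a1; suff Vz : ball x1 p (y + a *: w).
    by split; [exact: OV|exact: lower].
  move: yp ywp; rewrite -!ball_normE /= => yp ywp.
  have -> : x1 - (y + a *: w) = (1 - a) *: (x1 - y) + a *: (x1 - (y + w)) by module.
  rewrite (le_lt_trans (ler_normD _ _))// !normrZ !ger0_norm ?subr_ge0//.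
  have [->|an0] := eqVneq a 0; first by lra.
  have ap : 0 < a by rewrite lt_neqAle eq_sym an0.
  have : a * `|x1 - (y + w)| < a * p by rewrite ltr_pM2l.
  have : (1 - a) * `|x1 - y| <= (1 - a) * p by rewrite ler_wpM2l ?subr_ge0// ltW.
  lra.
move=> y w yp ywp; rewrite ler_norml; apply/andP; split.
  by have := half y w yp ywp; lra.
have := half (y + w) (- w) ywp; rewrite addrK => /(_ yp).
by rewrite normrN !(linear_formE lxi); lra.
Unshelve. all: by end_near. Qed.

(** The forms xi for different e need no comparison: they cancel in second differences, whose phi is
    thus o(|w|). This makes the derivative linear; the remainder plus its error term lies in K,
    where phi dominates c times the norm. *)
Lemma frechet_of_near_linear phi c x : dual_cone K phi -> 0 < c ->
  (forall y, K y -> c * `|y| <= phi y) -> Omega x ->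
  (forall e, 0 < e -> exists2 r, 0 < r & near_linear phi e (ball x r)) ->
  differentiable f x.
Proof.
move=> [[lphi cphi] Kphi] c0 Kc Ox nl.
have small e : 0 < e -> exists2 r, 0 < r & forall w, `|w| < r ->
    [/\ Omega (x + w), Omega (x - w) & phi (second_diff x w) <= e * `|w|].
  move=> e0; have e20 : 0 < e / 2 by rewrite divr_gt0.
  have [r r0 [xi [lxi xiP]]] := nl _ e20.
  have [r' [M [r'0 xr']]] := locally_bounded Ox.
  exists (Num.min r r'); first by rewrite lt_min r0.
  move=> w; rewrite lt_min => /andP[wr wr']; split.
  - by apply: (xr' _ _).1; rewrite addrAC subrr add0r ltW.
  - by apply: (xr' _ _).1; rewrite addrAC subrr add0r normrN ltW.
  - have xx : ball x r x by exact: ballxx.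
    have xw : ball x r (x + w).
      by rewrite -ball_normE /= opprD addrA subrr add0r normrN.
    have xw' : ball x r (x - w).
      by rewrite -ball_normE /= opprB addrC subrK.
    have := le_trans (ler_norm _) (xiP _ _ xx xw).
    have := le_trans (ler_norm _) (xiP _ _ xx xw').
    rewrite normrN /second_diff !(linear_formE lxi) !(linear_formE lphi); lra.
have asmall := alpha_small alpha_nd alpha_lim.
have phik : 0 <= phi k by exact: Kphi.
have Cp : 0 < 1 + 2 * C * phi k by rewrite ltr_pwDl// !mulr_ge0// ltW.
have bound e : 0 < e -> exists2 r, 0 < r & forall w, `|w| < r ->
    [/\ Omega (x + w), Omega (x - w) &
    phi (second_diff x w) + 2 * C * alpha `|w| * phi k <= e * `|w|].
  move=> e0; pose e' := e / (1 + 2 * C * phi k).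
  have e'0 : 0 < e' by rewrite divr_gt0.
  have [r r0 rP] := small _ e'0; have [r' r'0 r'P] := asmall _ e'0.
  exists (Num.min r r'); first by rewrite lt_min r0.
  move=> w; rewrite lt_min => /andP[wr wr']; have [Op Om sd] := rP _ wr.
  have aw := r'P _ (normr_ge0 _) wr'; split => //.
  have -> : e * `|w| = e' * `|w| + 2 * C * (e' * `|w|) * phi k.
    by rewrite /e'; field; rewrite gt_eqF.
  by rewrite lerD// ler_wpM2r// ler_wpM2l// mulr_ge0// ltW.
have rderivN h : rderiv x h + rderiv x (- h) = 0.
  have Kp := rderiv_pair h Ox; apply/eqP; rewrite -normr_le0.
  suff : c * `|rderiv x h + rderiv x (- h)| <= 0 by rewrite pmulr_rle0.
  apply: (le_trans (Kc _ Kp)); apply/ler_addgt0Pr => e e0; rewrite add0r.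
  have h1 : 0 < `|h| + 1 by rewrite ltr_wpDl.
  have [r r0 rP] := bound _ (divr_gt0 e0 h1).
  pose t := r / (`|h| + 1) / 2; have t0 : 0 < t by rewrite !divr_gt0.
  have nth : `|t *: h| = t * `|h| by rewrite normrZ gtr0_norm.
  have thr : `|t *: h| < r.
    rewrite nth; have : t * (`|h| + 1) = r / 2 by rewrite /t; field; rewrite gt_eqF.
    nra.
  have [Op Om] := rP _ thr; rewrite nth => H.
  have := rderiv_pair_le t0 Ox Op Om.
  move: (second_diff x (t *: h)) H => S H /Kphi; rewrite !(linear_formE lphi) => P.
  have {}P : phi (rderiv x h) + phi (rderiv x (- h)) <=
      (phi S + 2 * C * alpha (t * `|h|) * phi k) / t.
    rewrite -subr_ge0; apply: (le_trans P).
    by rewrite le_eqVlt; apply/orP; left; apply/eqP; field; rewrite gt_eqF.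
  apply: (le_trans P); rewrite ler_pdivrMr// (le_trans H)//.
  have -> : e / (`|h| + 1) * (t * `|h|) = (e * t) * (`|h| / (`|h| + 1)).
    by field; rewrite gt_eqF.
  have et : 0 <= e * t by rewrite mulr_ge0// ltW.
  by rewrite ler_piMr// ler_pdivrMr// mul1r lerDl.
have ldd := rderiv_linear Ox rderivN.
have [L L0 rderivL] := rderiv_bounded Ox.
pose df : {linear X -> Y} :=
  HB.pack (rderiv x) (GRing.isLinear.Build _ _ _ _ (rderiv x) ldd).
have dfc : continuous df by exact: linf_continuous ldd L rderivL.
have dfx : f \o shift x = cst (f x) + df +o_ 0 id.
  apply/eqaddoP => e e0.
  (* The first summand pays for u w, the second for the error term in k; the 1 is slack. *)
  pose D := c^-1 + C * `|k| + 1; pose e' := e / D.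
  have D0 : 0 < D.
    by rewrite ltr_wpDl// addr_ge0 ?invr_ge0 ?(ltW c0)// mulr_ge0// ltW.
  have e'0 : 0 < e' by rewrite divr_gt0.
  have [r r0 rP] := bound _ e'0; have [r' r'0 r'P] := asmall _ e'0.
  apply/nbhs_ballP; exists (Num.min r r'); first by rewrite /= lt_min r0.
  move=> w; rewrite -ball_normE /= sub0r normrN lt_min => /andP[wr wr'].
  have [Op Om H] := rP _ wr.
  have aw := r'P _ (normr_ge0 _) wr'.
  rewrite -[X in `|X|]/(f (w + x) - (f x + rderiv x w)) [w + x]addrC.
  have Op1 : Omega (x + 1 *: w) by rewrite scale1r.
  have Om1 : Omega (x + 1 *: - w) by rewrite scale1r.
  pose u z := f (x + z) - f x - rderiv x z + (C * alpha `|z|) *: k.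
  have uE z : diff_quot x z 1 + (C * (alpha (1 * `|z|) / 1)) *: k - rderiv x z = u z.
    by rewrite /u /diff_quot invr1 !scale1r mul1r mulr1; module.
  have Ku : K (u w) by rewrite -uE; apply: rderiv_le.
  have Ku' : K (u (- w)) by rewrite -uE; apply: rderiv_le.
  have uw : c * `|u w| <= e' * `|w|.
    (* u w and u (- w) lie in K, and by linearity of the derivative their sum is the second
       difference plus twice the error term. *)
    apply: (le_trans (Kc _ Ku)); apply: le_trans H.
    have := Kphi _ Ku'.
    have -> : u (- w) = second_diff x w + (2 * C * alpha `|w|) *: k - u w.
      rewrite /u normrN (linfN ldd) /second_diff; module.
    by rewrite (linfB lphi) (linfD lphi) (linfZ lphi) subr_ge0.
  have -> : f (x + w) - (f x + rderiv x w) = u w - (C * alpha `|w|) *: k.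
    by rewrite /u; module.
  have -> : e * `|w| = c^-1 * (e' * `|w|) + C * (e' * `|w|) * `|k| + e' * `|w|.
    by rewrite -[e in LHS](divfK (lt0r_neq0 D0)) -/e' /D; ring.
  apply: (le_trans (ler_normB _ _)).
  have h1 : `|u w| <= c^-1 * (e' * `|w|) by rewrite ler_pdivlMl.
  have h2 : `|(C * alpha `|w|) *: k| <= C * (e' * `|w|) * `|k|.
    rewrite normrZ ger0_norm; last by rewrite mulr_ge0 ?(ltW C0) ?alpha_ge0.
    by rewrite ler_wpM2r// ler_wpM2l// ltW.
  have h3 : 0 <= e' * `|w| by rewrite mulr_ge0// ltW.
  lra.
have dE := diff_unique dfc dfx.
by apply/diff_locallyP; rewrite dE.
Qed.

(** [W n] is open because near-linearity passes to smaller balls, and dense by [near_linear_dense];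
    the intersection over n covers every e. *)
Lemma frechet_generic : asplund X -> has_bounded_base K ->
  on_dense_Gdelta Omega (fun x => differentiable f x).
Proof.
move=> aspX /bounded_base_dual[phi [c [Kphi c0 Kc]]].
pose W n := [set x | exists2 r, 0 < r &
  ball x r `<=` Omega /\ near_linear phi n.+1%:R^-1 (ball x r)].
apply: (on_dense_Gdelta_impl _ (on_dense_Gdelta_bigcap openO (O := W) _ _)).
- move=> x Ox xW; apply: (frechet_of_near_linear Kphi c0 Kc Ox) => e e0.
  have [n ne] : exists n, n.+1%:R^-1 <= e.
    exists (Num.trunc e^-1); rewrite -[leRHS]invrK lef_pV2 ?posrE ?invr_gt0//.
    by rewrite ltW// truncnS_gt.
  have [r r0 [_ [xi [lxi xiP]]]] := xW n.
  exists r => //; exists xi; split => // y w yr ywr.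
  by rewrite (le_trans (xiP y w yr ywr))// ler_wpM2r.
- move=> n; rewrite openE => x [r r0 [rO [xi [lxi xiP]]]].
  have r20 : 0 < r / 2 by rewrite divr_gt0.
  apply/nbhs_ballP; exists (r / 2) => //= y xy; exists (r / 2) => //.
  have sub : ball y (r / 2) `<=` ball x r by move=> z; exact: ball_split.
  split; first exact: subset_trans rO.
  by exists xi; split => // z w /sub zr /sub; exact: xiP.
- move=> n x Ox B xB; have n0 : (0 : R) < n.+1%:R^-1 by rewrite invr_gt0.
  have [x1 [r [r0 rBO nl]]] := near_linear_dense aspX Kphi n0 Ox xB.
  exists x1; split; last by have [] := rBO x1 (ballxx _ r0).
  by exists r => //; split => // y /rBO[].
Qed.

End Paraconvex.

Theorem theorem5p1 (R : realType) (X Y : completeNormedModType R)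
    (alpha : R -> R) (K : set Y) (k : Y) (Omega : set X) (f : X -> Y)
    (alpha_ge0 : forall t : R, 0 <= t -> 0 <= alpha t)
    (alpha_nd : forall s t : R, 0 <= s -> s <= t -> alpha s <= alpha t)
    (alpha_lim : alpha t / t @[t --> 0^'+] --> (0 : R))
    (reflY : reflexive_space Y) (sepY : separable_space Y)
    (clK : closed K) (coneK : convex_cone K) (normK : normal_cone K)
    (kK : K k) (k_neq0 : k != 0)
    (openO : open Omega)
    (convO : convex_set (Omega : set (convex_lmodType X)))
    (paraf : strongly_paraconvex K alpha k Omega f) :
  (separable_space X -> asplund X -> has_bounded_base K ->
     on_dense_Gdelta Omega (fun x => differentiable f x)) /\
  (separable_space X ->
     on_dense_Gdelta Omega (fun x => gateaux_differentiable f x)).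
Proof.
have [cf [C C0 fC]] := paraf; split => [_ aspX baseK|sepX].
  exact: (frechet_generic alpha_ge0 alpha_nd alpha_lim reflY clK coneK normK kK
    openO cf C0 fC).
exact: (gateaux_generic alpha_ge0 alpha_nd alpha_lim reflY clK coneK normK kK
  openO cf C0 fC).
Qed.
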